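(* Consider a sequence of problems indexed by the sample size $n\to\infty$, with $d=d_n\to\infty$ and with $s$, $T$, $\theta>0$ and $G_*$ allowed to depend on $n$. Let $G_*$ be a graph on $\{1,\dots,d\}$ with $s$ non-isolated vertices. Under the statistical query (oracle computational) model, if $T\le d^p$ for some constant $p>0$, $s\le d^{(1-\eta)/2}$ for some constant $\eta>0$, and $$\theta\le\kappa\sqrt{\frac1n}\ \wedge\ \frac1{16s},$$ where $\kappa$ is some sufficiently small positive constant, then $$\liminf_{n\to\infty}\gamma_{\mathrm{oracle}}\{\mathcal S[\mathcal G_1(G_* ),\theta]\}=1.$$
   Context: Ising model: for a symmetric $\Theta=(\theta_{ij})\in\mathbb R^{d\times d}$ with zero diagonal and nonnegative entries, $\mathbb P_\Theta(X)=\frac1{Z_\Theta}\exp\big(\sum_{i,j=1}^d\theta_{ij}X_iX_j\big)$ on $\{\pm1\}^d$, where $Z_\Theta$ is the normalizing constant (the sum runs over all ordered pairs $(i,j)$); $\mathbb P_0$ is the case $\Theta=0$. $G(\Theta)$ is the graph on $\{1,\dots,d\}$ with edges $\{(i,j):\theta_{ij}\ne0\}$. $\mathcal G_1(G_* )$ is the class of all graphs on $\{1,\dots,d\}$ containing a subgraph isomorphic to $G_*$. For $\theta>0$, $\mathcal S(\mathcal G_1,\theta)=\{\Theta:\Theta=\Theta^T,\ \Theta\text{ has zero diagonal},\ G(\Theta)\in\mathcal G_1,\ \|\Theta\|_F\le1/2,\ \min_{(i,j)\in E[G(\Theta)]}\theta_{ij}\ge\theta\}$, where $\|\cdot\|_F$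 is the Frobenius norm and $E[G]$ the edge set. $a\wedge b=\min$. The $\psi_1$-norm is $\|Z\|_{\psi_1}=\sup_{p\ge1}p^{-1}(\mathbb E|Z|^p)^{1/p}$, and $Z$ is sub-exponential if it is finite. Let $X$ be the random vector of interest and $\mathcal Q^*=\{q: q(X)\text{ is a sub-exponential variable}\}$. Every subset $\mathcal Q\subseteq\mathcal Q^*$ is called a query space. Each query space has a capacity measure $\eta(\mathcal Q)>0$, with $\eta(\mathcal Q)=\log|\mathcal Q|$ when $\mathcal Q$ is finite (this is unrelated to the exponent constant $\eta$ in the theorem). Statistical query oracle: a statistical query oracle $r_n$ on $\mathcal Q$ (with sample size $n$) is a random mapping from $\mathcal Q$ to $\mathbb R$; given $q\in\mathcal Q$ it returns $Z_q\in\mathbb R$ such that for any tail probability $\xi\in[0,1)$, $$\mathbb P\Big(\bigcap_{q\in\mathcal Q}\{|Z_q-\mathbb E[q(X)]|\le\|q(X)\|_{\psi_1}\cdot\tau\}\Big)\ge1-2\xi,\quad \tau=\max\Big\{\frac{\eta(\mathcal Q)+\log(1/\xi)}n,\sqrt{\frac{2[\eta(\mathcal Q)+\log(1/\xi)]}n}\Big\}.$$ (Expectation and $\psi_1$-norm are with respect to the true distribution of $X$.) $R_n(\mathcal Q)$ is the set of all statistical query oracles on $\mathcal Q$ with sample size $n$. Oracle computational model: a test algorithm is a tuple $\Psi=(\mathcal Q_\Psi,T_\Psi,q_{\rm init},\{\delta_t\}_{t=1}^{T_\Psi},\psi)$, where $\mathcal Q_\Psi\subseteq\mathcal Q^*$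 contains all queries the test will potentially use; $T_\Psi$ is the maximum number of rounds in which the oracle is queried; $q_{\rm init}\in\mathcal Q_\Psi$ is the initial query; $\delta_t:(\mathcal Q_\Psi\times\mathbb R)^{t-1}\to\mathcal Q_\Psi\cup\{\mathrm{HALT}\}$ is the transition function at round $t$ (if it returns HALT the querying stops); and $\psi:(\mathcal Q_\Psi\times\mathbb R)^{T_\Psi}\to\{0,1\}$ is the test function, taking the results of the at most $T_\Psi$ queries and returning the test result. $\mathscr A(T)=\{\Psi:T_\Psi\le T\}$. Oracle risk with maximum query complexity $T$: $$\gamma_{\mathrm{oracle}}\{\mathcal S\}=\inf_{\Psi\in\mathscr A(T)}\ \sup_{r_n\in R_n(\mathcal Q_\Psi)}\Big\{\mathbb P_0(\psi=1)+\max_{\Theta\in\mathcal S}\mathbb P_\Theta(\psi=0)\Big\},$$ where $\mathbb P_0(\psi=1)$, $\mathbb P_\Theta(\psi=0)$ are the probabilities of the test outcome when the algorithm interacts with the oracle $r_n$ and the true distribution of $X$ is $\mathbb P_0$, respectively $\mathbb P_\Theta$. *)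

(* Defs.v *)
From HB Require Import structures.
From mathcomp Require Import all_boot all_order all_algebra finmap.
From mathcomp Require Import all_classical all_reals all_analysis.

Set Implicit Arguments.
Unset Strict Implicit.
Unset Printing Implicit Defensive.

Import Order.TTheory GRing.Theory Num.Theory.

Local Open Scope classical_set_scope.
Local Open Scope ring_scope.

Section Distributions.
Variables (R : realType) (d : nat).

(* A point of {-1, 1}^d is a family of bits; bit b stands for the spin (-1)^b. *)
Definition cube := {ffun 'I_d -> bool}.

Definition spin (x : cube) (i : 'I_d) : R := (-1) ^+ x i.

Record law := Law {
  law_val :> cube -> R;
  law_ge0 : forall x, 0 <= law_val x;
  law_sum1 : \sum_x law_val x = 1 }.

Definition mean (P : law) (f : cube -> R) : R := \sum_x P x * f x.

(* The sum in the exponent runs over ordered pairs: each edge counts twice. *)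
Definition ising_weight (Theta : 'M[R]_d) (x : cube) : R :=
  expR (\sum_i \sum_j Theta i j * spin x i * spin x j).

Definition ising_Z (Theta : 'M[R]_d) : R := \sum_x ising_weight Theta x.

Lemma ising_Z_gt0 Theta : 0 < ising_Z Theta.
Proof.
rewrite /ising_Z (bigD1 [ffun=> false]) //= ltr_wpDr ?expR_gt0 //.
by apply: sumr_ge0 => x _; exact: expR_ge0.
Qed.

Lemma ising_ge0 Theta x : 0 <= ising_weight Theta x / ising_Z Theta.
Proof. by rewrite divr_ge0 ?expR_ge0 // ltW // ising_Z_gt0. Qed.

Lemma ising_sum1 Theta : \sum_x ising_weight Theta x / ising_Z Theta = 1.
Proof. by rewrite -mulr_suml mulfV // gt_eqF // ising_Z_gt0. Qed.

Definition ising (Theta : 'M[R]_d) : law :=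
  Law (ising_ge0 Theta) (ising_sum1 Theta).

End Distributions.

Section Models.
Variables (R : realType) (d : nat).

Definition simple_graph (G : rel 'I_d) : Prop := symmetric G /\ irreflexive G.

Definition nonisolated (G : rel 'I_d) : {set 'I_d} :=
  [set i | [exists j, G i j]].

(* The pattern has the same vertex set as its hosts, so a subgraph isomorphic
   to it is the image of the pattern under an injection of 'I_d into itself. *)
Definition G1 (Gstar : rel 'I_d) : set (rel 'I_d) :=
  [set G | simple_graph G /\
    exists2 f : 'I_d -> 'I_d, injective f &
      forall i j, Gstar i j -> G (f i) (f j)].

Definition graph_of (Theta : 'M[R]_d) : rel 'I_d :=
  [rel i j | Theta i j != 0].

Definition frobenius (Theta : 'M[R]_d) : R :=
  Num.sqrt (\sum_i \sum_j Theta i j ^+ 2).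

(* The minimum of an empty set of edge weights is read as +oo. *)
Definition signals (GG : set (rel 'I_d)) (theta : R) : set 'M[R]_d :=
  [set Theta | [/\ Theta = Theta^T, forall i, Theta i i = 0,
                   GG (graph_of Theta), frobenius Theta <= 1 / 2 &
                   forall i j, graph_of Theta i j -> theta <= Theta i j]].

End Models.

Section Queries.
Variables (R : realType) (d : nat).

Definition query := cube d -> R.

Definition psi1 (P : law R d) (q : query) : \bar R :=
  ereal_sup [set (p^-1 * mean P (fun x => `|q x| `^ p) `^ p^-1)%:E
            | p in [set p : R | 1 <= p]].

Definition sub_exponential (P : law R d) (q : query) : Prop :=
  (psi1 P q < +oo)%E.

(* The space Q^* must not depend on the unknown law of X, hence the
   quantification over all laws on the cube. *)
Definition Qstar : set query :=
  [set q | forall P : law R d, sub_exponential P q].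

(* The capacity of a singleton is log 1 = 0, so strict positivity is only
   imposed on infinite query spaces. *)
Definition is_capacity (cap : set query -> R) : Prop :=
  forall Q : set query, Q `<=` Qstar -> Q !=set0 ->
    (finite_set Q -> cap Q = ln (#|` fset_set Q|%:R)) /\
    (infinite_set Q -> 0 < cap Q).

(* log(1/0) = +oo, whence the value +oo at xi = 0. *)
Definition tau (n : nat) (c xi : R) : \bar R :=
  if xi == 0 then +oo%E
  else (Num.max ((c + ln (1 / xi)) / n%:R)
                (Num.sqrt (2 * (c + ln (1 / xi)) / n%:R)))%:E.

Record random_map (Q : set query) := RandomMap {
  rm_disp : measure_display;
  rm_space : measurableType rm_disp;
  rm_prob : probability rm_space R;
  rm_val : rm_space -> Q -> R }.

(* The guarantee refers to the true law of X, so an oracle consists of one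
   random mapping for each possible law; a test only sees the mapping. *)
Definition oracle (Q : set query) := law R d -> random_map Q.

Definition accurate (n : nat) (c xi : R) (P : law R d) (Q : set query)
    (z : Q -> R) : Prop :=
  forall q : Q,
    (`|z q - mean P (\val q)|%:E <= psi1 P (\val q) * tau n c xi)%E.

Definition is_oracle (cap : set query -> R) (n : nat) (Q : set query)
    (r : oracle Q) : Prop :=
  forall (P : law R d) (xi : R), 0 <= xi < 1 ->
    let good := [set w | accurate n (cap Q) xi P (rm_val (r := r P) w)] in
    measurable good /\ ((1 - 2 * xi)%:E <= rm_prob (r P) good)%E.

(* A history lists the past (query, answer) pairs, oldest first. The family of
   transition functions is one function on histories, delta_t being its
   restriction to histories of length t - 1; None is HALT. *)
Record algorithm := Algorithm {
  alg_Q : set query;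
  alg_Qstar : alg_Q `<=` Qstar;
  alg_T : nat;
  alg_init : alg_Q;
  alg_delta : seq (alg_Q * R) -> option alg_Q;
  alg_psi : seq (alg_Q * R) -> bool }.

Fixpoint rounds (Q : set query) (delta : seq (Q * R) -> option Q)
    (z : Q -> R) (k : nat) (h : seq (Q * R)) : seq (Q * R) :=
  if k is k'.+1 then
    if delta h is Some q then rounds delta z k' (rcons h (q, z q)) else h
  else h.

(* The first round asks the initial query; later rounds follow alg_delta. *)
Definition transcript (A : algorithm) (z : alg_Q A -> R) :
    seq (alg_Q A * R) :=
  if alg_T A is k.+1 then
    rounds (@alg_delta A) z k [:: (alg_init A, z (alg_init A))]
  else [::].

Definition outcome (A : algorithm) (r : oracle (alg_Q A)) (P : law R d)
    (b : bool) : set (rm_space (r P)) :=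
  [set w | alg_psi (transcript (rm_val (r := r P) w)) = b].

Arguments outcome {A} r P b.

Definition outcome_prob (A : algorithm) (r : oracle (alg_Q A)) (P : law R d)
    (b : bool) : \bar R :=
  rm_prob (r P) (outcome r P b).

(* A test may be an arbitrary function of its transcript; its error
   probabilities against an oracle make sense when this holds. *)
Definition measurable_outcome (A : algorithm) (r : oracle (alg_Q A)) : Prop :=
  forall P b, measurable (outcome r P b).

Definition total_error (A : algorithm) (r : oracle (alg_Q A))
    (S : set 'M[R]_d) : \bar R :=
  (outcome_prob r (ising 0) true +
   ereal_sup [set outcome_prob r (ising Theta) false | Theta in S])%E.

Definition worst_error (cap : set query -> R) (n : nat) (A : algorithm)
    (S : set 'M[R]_d) : \bar R :=
  ereal_sup [set v | exists r : oracle (alg_Q A),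
    [/\ is_oracle cap n r, measurable_outcome r & v = total_error r S]].

Definition oracle_risk (cap : set query -> R) (n T : nat)
    (S : set 'M[R]_d) : \bar R :=
  ereal_inf [set v | exists2 A : algorithm,
    (alg_T A <= T)%N & v = worst_error cap n A S].

End Queries.

(* Main.v *)
(* The graph class contains the cliques on s vertices, so it suffices to fool
   the test with the laws P_A proportional to exp (theta M_A^2), where M_A is
   the sum of the spins in A. The sets A are the transversals of s disjoint
   blocks of m = d / s vertices: since s^2 / d <= d^(-eta), two of them share
   more than K vertices only with probability of order d^(-eta (K + 1)), far
   below 1 / T once K is large compared with p / eta. The covariance of the
   weights of two transversals is O(theta^2) when they share at most K
   vertices, and always O(theta^2 s^4). By Cauchy-Schwarz, a query separating
   the null mean from the P_A mean by more than C theta times its L2 norm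
   does so only for a fraction below 1 / (2 T) of the transversals, so some
   transversal A defeats all T queries asked along the null transcript. The
   L2 norm is at most a constant times the psi_1 norm under P_A, hence, for
   theta <= kappa / sqrt n, an oracle may answer every one of them by its
   null mean, and the test cannot tell P_A from the null law. *)

Require Import Defs.
From HB Require Import structures.
From mathcomp Require Import all_boot all_order all_algebra.
From mathcomp Require Import all_classical all_reals all_analysis.
From mathcomp Require Import lra zify.

Set Implicit Arguments.
Unset Strict Implicit.
Unset Printing Implicit Defensive.

Import Order.TTheory GRing.Theory Num.Theory.

Local Open Scope ring_scope.

(** * Averages over the uniform law on the cube *)

Section UniformAverage.
Variables (R : realType) (d : nat).
Implicit Types (f g h : cube d -> R) (A : {set 'I_d}) (x y : cube d).

Definition avg f : R := #|{: cube d}|%:R^-1 * \sum_x f x.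

Lemma card_cube_gt0 : 0 < #|{: cube d}|%:R :> R.
Proof. by rewrite ltr0n; apply/card_gt0P; exists [ffun=> false]. Qed.

Lemma eq_avg f g : f =1 g -> avg f = avg g.
Proof. by move=> fg; congr (_ * _); apply: eq_bigr => x _. Qed.

Lemma avgD f g : avg (fun x => f x + g x) = avg f + avg g.
Proof. by rewrite /avg big_split mulrDr. Qed.

Lemma avgZ (a : R) f : avg (fun x => a * f x) = a * avg f.
Proof. by rewrite /avg -mulr_sumr mulrCA. Qed.

Lemma avgN f : avg (fun x => - f x) = - avg f.
Proof. by rewrite /avg sumrN mulrN. Qed.

Lemma avgB f g : avg (fun x => f x - g x) = avg f - avg g.
Proof. by rewrite avgD avgN. Qed.

Lemma avg_sum (I : Type) (r : seq I) (P : pred I) (F : I -> cube d -> R) :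
  avg (fun x => \sum_(i <- r | P i) F i x) = \sum_(i <- r | P i) avg (F i).
Proof. by rewrite /avg exchange_big -mulr_sumr. Qed.

Lemma avg_cst (a : R) : avg (fun=> a) = a.
Proof.
rewrite /avg sumr_const -[X in _ * X]mulr_natl mulrA mulVf ?mul1r//.
by rewrite gt_eqF// card_cube_gt0.
Qed.

Lemma ler_avg f g : (forall x, f x <= g x) -> avg f <= avg g.
Proof.
move=> fg; rewrite ler_wpM2l ?invr_ge0 ?ler0n//.
by apply: ler_sum => x _.
Qed.

Lemma avg_ge0 f : (forall x, 0 <= f x) -> 0 <= avg f.
Proof. by move=> f0; rewrite -(avg_cst 0); exact: ler_avg. Qed.

Lemma avg_reindex (s : cube d -> cube d) f :
  involutive s -> avg (fun x => f (s x)) = avg f.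
Proof.
by move=> sK; congr (_ * _); rewrite [RHS](reindex_inj (inv_inj sK)).
Qed.

(** With [s] a sign flip, this is how exponentials are turned into hyperbolic cosines. *)
Lemma avg_symmetrize (s : cube d -> cube d) f :
  involutive s -> avg f = avg (fun x => (f x + f (s x)) / 2).
Proof.
move=> sK; rewrite [RHS](@eq_avg _ (fun x => 2^-1 * f x + 2^-1 * f (s x))).
  by rewrite avgD !avgZ avg_reindex//; lra.
by move=> x; lra.
Qed.

(** Lagrange's identity: the squares [(F i * G j - F j * G i) ^+ 2] sum to twice the difference of
    the two sides. *)
Lemma sum_CauchySchwarz (I : finType) (F G : I -> R) :
  (\sum_i F i * G i) ^+ 2 <= (\sum_i F i ^+ 2) * \sum_i G i ^+ 2.
Proof.
have : 0 <= \sum_i \sum_j (F i * G j - F j * G i) ^+ 2.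
  by apply: sumr_ge0 => x _; apply: sumr_ge0 => y _; exact: sqr_ge0.
rewrite (eq_bigr (fun i => F i ^+ 2 * (\sum_j G j ^+ 2) +
  (G i ^+ 2 * (\sum_j F j ^+ 2) - 2 * (F i * G i) * (\sum_j F j * G j)))).
  rewrite big_split sumrB -!mulr_suml -mulr_sumr/=; lra.
move=> i _; rewrite !mulr_sumr -sumrB -big_split/=.
by apply: eq_bigr => j _; lra.
Qed.

Lemma avg_CauchySchwarz f g :
  avg (fun x => f x * g x) ^+ 2
    <= avg (fun x => f x ^+ 2) * avg (fun x => g x ^+ 2).
Proof.
rewrite /avg exprMn [leRHS]mulrACA -[X in _ <= X * _]expr2 ler_wpM2l ?sqr_ge0//.
exact: sum_CauchySchwarz.
Qed.

Definition depends_on A f :=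
  forall x y, {in A, x =1 y} -> f x = f y.

(* Exchanging the coordinates in A between two independent copies of the cube
   preserves the uniform law on pairs. *)
Lemma avg_indep A f g : depends_on A f -> depends_on (~: A) g ->
  avg (fun x => f x * g x) = avg f * avg g.
Proof.
move=> fA gA.
pose swap (p : cube d * cube d) : cube d * cube d :=
  ([ffun i => if i \in A then p.1 i else p.2 i],
   [ffun i => if i \in A then p.2 i else p.1 i]).
have swapK : involutive swap.
  by move=> [x y]; congr (_, _); apply/ffunP => i;
     rewrite ffunE/= !ffunE/=; case: (i \in A).
have H : (\sum_x f x) * (\sum_x g x) = #|{: cube d}|%:R * \sum_x f x * g x.
  (* After the exchange both factors only see coordinates of the first copy, so the sum over the
     second copy merely counts points. *)
  rewrite big_distrlr pair_big/= (reindex_inj (inv_inj swapK))/=.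
  rewrite -(pair_big xpredT xpredT (fun x y => f (swap (x, y)).1 *
    g (swap (x, y)).2))/= mulr_sumr; apply: eq_bigr => x _.
  rewrite (eq_bigr (fun=> f x * g x)) ?sumr_const ?mulr_natl// => y _.
  congr (_ * _); [apply: fA|apply: gA] => i;
    by rewrite ?inE ffunE/=; case: (i \in A).
rewrite /avg mulrACA H -!mulrA; congr (_ * _); rewrite mulrA mulVf ?mul1r//.
by rewrite gt_eqF// card_cube_gt0.
Qed.

End UniformAverage.

(** * Bounds on the exponential and the hyperbolic cosine *)

Section RealEstimates.
Variable R : realType.

Lemma expR1_le4 : expR 1 <= 4 :> R.
Proof.
have <- : expR (2^-1 : R) ^+ 2 = expR 1.
  by rewrite -expRM_natl; congr expR; lra.
have h := @expR_ge1Dx R (- 2^-1); have := @expRxMexpNx_1 R 2^-1.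
by have := @expR_gt0 R 2^-1; nra.
Qed.

(** From [1 - w <= expR (- w)] comes [expR w <= 1 / (1 - w)]; the constant 4/3 is what lets the
    quadratic dominate this quotient up to [w = 1/4]. *)
Lemma expR_quadratic_ub (w : R) : `|w| <= 4^-1 ->
  expR w <= 1 + w + 4 / 3 * w ^+ 2.
Proof.
rewrite ler_norml => /andP[w1 w2].
have h := expR_ge1Dx (- w); have h1 := expRxMexpNx_1 w.
have e0 := expR_gt0 w.
have : expR w * (1 - w) <= 1 by nra.
have q : 1 <= (1 - w) * (1 + w + 4 / 3 * w ^+ 2).
  rewrite (_ : _ * _ = 1 + w ^+ 2 * ((1 - 4 * w) / 3)); last by lra.
  by rewrite lerDl mulr_ge0 ?sqr_ge0//; lra.
have w0 : 0 < 1 - w by lra.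
move=> p; rewrite -(ler_pM2r w0) [leRHS]mulrC.
exact: le_trans p q.
Qed.

(** The quadratic bounds at [u / 2] and [- u / 2], squared and added, stay below
    [2 * (1 + u ^+ 2)]. *)
Lemma cosh_le_small (u : R) : `|u| <= 2^-1 ->
  expR u + expR (- u) <= 2 * expR (u ^+ 2).
Proof.
move=> u2; set w := u / 2.
have w4 : `|w| <= 4^-1 by rewrite normrM [`|2^-1|]ger0_norm//; lra.
have p := expR_quadratic_ub w4.
have := @expR_quadratic_ub (- w); rewrite normrN sqrrN => /(_ w4) m.
have -> : u = 2%:R * w by rewrite /w; lra.
rewrite -mulrN !expRM_natl.
have e1 := ltW (expR_gt0 w); have e2 := ltW (expR_gt0 (- w)).
have p2 : expR w ^+ 2 <= (1 + w + 4 / 3 * w ^+ 2) ^+ 2.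
  by rewrite ler_sqr ?nnegrE// (le_trans e1 p).
have m2 : expR (- w) ^+ 2 <= (1 - w + 4 / 3 * w ^+ 2) ^+ 2.
  by rewrite ler_sqr ?nnegrE// (le_trans e2 m).
have h := expR_ge1Dx ((2%:R * w) ^+ 2).
have ww : w ^+ 2 <= 16^-1.
  by rewrite -[leLHS]real_normK ?num_real//; have := normr_ge0 w; nra.
have : 0 <= w ^+ 2 * (1 - 16 * w ^+ 2) by rewrite mulr_ge0 ?sqr_ge0//; lra.
by have := sqr_ge0 w; lra.
Qed.

(* Halving the argument works because cosh (2u) <= cosh(u)^4. *)
Lemma cosh_le (u : R) : expR u + expR (- u) <= 2 * expR (u ^+ 2).
Proof.
have [u1|u1] := leP `|u| 1.
  pose w := u / 2.
  have : `|w| <= 2^-1 by rewrite normrM [`|2^-1|]ger0_norm//; lra.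
  move/cosh_le_small; have -> : u = 2%:R * w by rewrite /w; lra.
  have -> : (2%:R * w) ^+ 2 = 4%:R * w ^+ 2 by lra.
  have -> : - (2%:R * w) = 2%:R * (- w) by lra.
  rewrite !expRM_natl.
  have := expRxMexpNx_1 w; have := expR_gt0 w; have := expR_gt0 (- w).
  move: (expR w) (expR (- w)) (expR (w ^+ 2)) => a b c b0 a0 ab abc.
  have c1 : ((a + b) / 2) ^+ 4 <= c ^+ 4.
    by apply: lerXn2r; rewrite ?nnegrE; lra.
  have : (a + b) ^+ 2 = a ^+ 2 + b ^+ 2 + 2 by lra.
  set s := a + b in c1 * => hs.
  (* Here [s / 2] is the hyperbolic cosine of [w], and this square equals [cosh(w)^4 - cosh(2w)]. *)
  have : 0 <= (s ^+ 2 / 4 - 1) ^+ 2 by exact: sqr_ge0.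
  by nra.
have uu : `|u| <= u ^+ 2.
  by rewrite -real_normK ?num_real// expr2; nra.
rewrite mulrDl mul1r; apply: lerD; rewrite ler_expR; apply: le_trans uu.
  exact: ler_norm.
by rewrite -normrN ler_norm.
Qed.

End RealEstimates.

(** * Exponential moments of the squared magnetization *)

Section Magnetization.
Variables (R : realType) (d : nat).
Implicit Types (A B C S : {set 'I_d}) (x y : cube d) (a : R).

Definition flip A x : cube d := [ffun i => x i (+) (i \in A)].

Lemma flipK A : involutive (flip A).
Proof. by move=> x; apply/ffunP => i; rewrite !ffunE addbK. Qed.

Definition magnet A x : R := \sum_(i in A) spin R x i.

(** The Curie-Weiss density without normalization. The diagonal terms of the square only contribute
    a constant factor, so this is the Ising weight of a clique up to scaling. *)
Definition curie_weiss a A x : R := expR (a * magnet A x ^+ 2).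

Lemma spin_sqr x i : spin R x i ^+ 2 = 1.
Proof. by rewrite /spin sqrr_sign. Qed.

Lemma magnet_flip_in A S x : A \subset S -> magnet A (flip S x) = - magnet A x.
Proof.
move=> /fintype.subsetP AS; rewrite /magnet -sumrN; apply: eq_bigr => i /AS iS.
by rewrite /spin ffunE iS addbT signrN.
Qed.

Lemma magnet_flip_out A S x : [disjoint A & S] ->
  magnet A (flip S x) = magnet A x.
Proof.
move=> AS; apply: eq_bigr => i iA.
by rewrite /spin ffunE (disjointFr AS iA) addbF.
Qed.

Lemma magnetID A B x : magnet A x = magnet (A :\: B) x + magnet (A :&: B) x.
Proof. by rewrite /magnet (big_setID B)/= addrC. Qed.

Lemma magnet_le A x : `|magnet A x| <= #|A|%:R.
Proof.
apply: le_trans (ler_norm_sum _ _ _) _.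
rewrite (eq_bigr (fun=> 1)) ?sumr_const// => i _.
by rewrite /spin normrX normrN1 expr1n.
Qed.

Lemma magnet_sqr_le A x : magnet A x ^+ 2 <= #|A|%:R ^+ 2.
Proof.
rewrite -[leLHS]real_normK ?num_real// ler_sqr ?nnegrE ?ler0n//.
exact: magnet_le.
Qed.

Lemma magnet_depends A S (F : R -> R) : A \subset S ->
  depends_on S (fun x => F (magnet A x)).
Proof.
move=> /fintype.subsetP AS x y xy; congr F; apply: eq_bigr => i /AS iS.
by rewrite /spin xy.
Qed.

Lemma curie_weiss_gt0 a A x : 0 < curie_weiss a A x.
Proof. exact: expR_gt0. Qed.

Lemma curie_weiss_ge1 a A x : 0 <= a -> 1 <= curie_weiss a A x.
Proof.
move=> a0; apply: le_trans (expR_ge1Dx _).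
by rewrite lerDl mulr_ge0// sqr_ge0.
Qed.

Lemma avg_curie_weiss_ge1 a A : 0 <= a -> 1 <= avg (curie_weiss a A).
Proof.
move=> a0; rewrite -[leLHS](avg_cst d).
by apply: ler_avg => x; exact: curie_weiss_ge1.
Qed.

(* Averaging over one spin turns the coupling a into a + 4 a^2 and costs a
   factor e^a. *)
Lemma avg_curie_weiss_le a A : 0 <= a -> 8 * a * #|A|%:R <= 1 ->
  avg (curie_weiss a A) <= expR (2 * a * #|A|%:R).
Proof.
elim: {A}#|A| {-2}A (erefl #|A|) a => [|k IH] A cA a a0 aA.
  rewrite cA mulr0 expR0 -[leRHS](avg_cst d); apply: ler_avg => x.
  by rewrite /curie_weiss /magnet (cards0_eq cA) big_set0 expr0n/= mulr0 expR0.
have [i iA] : exists i, i \in A by apply/card_gt0P; rewrite cA.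
have cAi : #|A :\ i| = k by move: cA; rewrite (cardsD1 i) iA => -[].
pose a' := a + 4 * a ^+ 2.
have k0 : 0 <= k%:R :> R by exact: ler0n.
rewrite cA -natr1 in aA *.
have a'0 : 0 <= a' by rewrite addr_ge0// mulr_ge0// sqr_ge0.
have ak : 0 <= a * k%:R by rewrite mulr_ge0.
(* The smallness condition survives because [8 * a * k <= 1 - 8 * a] and
   [(1 - 8 * a) * (1 + 4 * a) <= 1]. *)
have a'k : 8 * a' * k%:R <= 1 by rewrite /a'; nra.
have := IH (A :\ i) cAi a' a'0; rewrite cAi => /(_ a'k) H.
have step x : (curie_weiss a A x + curie_weiss a A (flip [set i] x)) / 2
    <= expR a * curie_weiss a' (A :\ i) x.
  have dis : [disjoint A :\ i & [set i]].
    by rewrite disjoint_sym disjoints1 !inE eqxx.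
  have mA y : magnet A y = magnet (A :\ i) y + spin R y i.
    by rewrite /magnet (big_setD1 i)//= addrC.
  rewrite /curie_weiss !mA magnet_flip_out//.
  have -> : spin R (flip [set i] x) i = - spin R x i.
    by rewrite /spin ffunE inE eqxx addbT signrN.
  have := spin_sqr x i; move: (magnet _ _) (spin R x i) => M t t1.
  have -> : a * (M + t) ^+ 2 = a + a * M ^+ 2 + 2 * a * M * t.
    by rewrite sqrrD t1; lra.
  have -> : a * (M - t) ^+ 2 = a + a * M ^+ 2 + - (2 * a * M * t).
    by rewrite sqrrB t1; lra.
  have -> : a' * M ^+ 2 = a * M ^+ 2 + (2 * a * M * t) ^+ 2.
    by rewrite /a' [(2 * a * M * t) ^+ 2]exprMn t1; lra.
  rewrite !expRD -mulrDr -!mulrA !ler_pM2l ?expR_gt0//.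
  by rewrite ler_pdivrMr// [leRHS]mulrC !mulrA cosh_le.
apply: (@le_trans _ _ (avg (fun x => expR a * curie_weiss a' (A :\ i) x))).
  rewrite (avg_symmetrize _ (flipK [set i])).
  exact: ler_avg.
rewrite avgZ; apply: le_trans (ler_wpM2l (expR_ge0 _) H) _.
(* The exponents compare as soon as [8 * a ^+ 2 * k <= a], which the smallness condition gives. *)
rewrite -expRD ler_expR /a'; nra.
Qed.

End Magnetization.

(** * Covariances of clique weights under the uniform law *)

Section Covariance.
Variables (R : realType) (d : nat).
Implicit Types (A : {set 'I_d}) (x : cube d).

Definition cov (f g : cube d -> R) : R :=
  avg (fun x => f x * g x) - avg f * avg g.

Lemma expRB1_le (y : R) : expR y - 1 <= y * expR y.
Proof.
have := expR_ge1Dx (- y); have := expRxMexpNx_1 y.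
by have := expR_gt0 y; nra.
Qed.

Variables (theta : R) (s : nat).
Hypotheses (theta_ge0 : 0 <= theta) (s_gt0 : (0 < s)%N)
  (theta_s : 16 * theta * s%:R <= 1).

(** The doubled coupling is that of the squared weight, so this controls second moments. *)
Lemma avg_curie_weiss_double_le A : (#|A| <= s)%N ->
  avg (curie_weiss (2 * theta) A) <= expR (4^-1).
Proof.
have ts := theta_s; have t0 := theta_ge0.
rewrite -(ler_nat R) => As; have := ler_wpM2l theta_ge0 As => tA.
have A0 : 0 <= #|A|%:R :> R by exact: ler0n.
apply: le_trans (avg_curie_weiss_le _ _) _; [lra|lra|].
by rewrite ler_expR; lra.
Qed.

Lemma curie_weiss_sqr A x :
  curie_weiss theta A x ^+ 2 = curie_weiss (2 * theta) A x.
Proof. by rewrite /curie_weiss -expRM_natl mulrA. Qed.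

(** Subtracting 1 from both weights keeps the covariance, and each difference is at most
    [theta * s ^ 2] times the weight; what remains is a product of weights, bounded by second
    moments. Meant for the rare pairs with a large overlap. *)
Lemma cov_curie_weiss_le A A' : (#|A| <= s)%N -> (#|A'| <= s)%N ->
  cov (curie_weiss theta A) (curie_weiss theta A')
    <= (theta * s%:R ^+ 2) ^+ 2 * expR 1.
Proof.
move=> As A's; set W := curie_weiss theta A; set W' := curie_weiss theta A'.
have W1 : 1 <= avg W by exact: avg_curie_weiss_ge1.
have W'1 : 1 <= avg W' by exact: avg_curie_weiss_ge1.
have -> : cov W W' = avg (fun x => (W x - 1) * (W' x - 1))
    - (avg W - 1) * (avg W' - 1).
  rewrite (@eq_avg _ _ _ (fun x => (W x * W' x - W x) - (W' x - 1))).
    by rewrite !avgB avg_cst /cov; lra.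
  by move=> x; lra.
have t0 : 0 <= theta * s%:R ^+ 2 by rewrite mulr_ge0// sqr_ge0.
have bnd (C : {set 'I_d}) x : (#|C| <= s)%N -> 0 <= curie_weiss theta C x - 1
    <= theta * s%:R ^+ 2 * curie_weiss theta C x.
  move=> Cs; rewrite subr_ge0 curie_weiss_ge1//=.
  apply: le_trans (expRB1_le _) _.
  rewrite ler_pM2r ?expR_gt0// ler_wpM2l//.
  apply: le_trans (magnet_sqr_le _ _ _) _.
  by rewrite ler_sqr ?nnegrE ?ler0n// ler_nat.
apply: (@le_trans _ _ (avg (fun x => (theta * s%:R ^+ 2) ^+ 2 *
    ((curie_weiss (2 * theta) A x + curie_weiss (2 * theta) A' x) / 2)))).
  rewrite lerBlDr ler_wpDr ?mulr_ge0 ?subr_ge0//; apply: ler_avg => x.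
  have /andP[w0 w1] := bnd A x As; have /andP[w'0 w'1] := bnd A' x A's.
  apply: le_trans (ler_pM w0 w'0 w1 w'1) _.
  rewrite mulrACA -expr2 ler_wpM2l ?sqr_ge0// -!curie_weiss_sqr.
  by have := sqr_ge0 (W x - W' x); rewrite /W /W'; nra.
rewrite avgZ ler_wpM2l ?sqr_ge0//.
rewrite (@eq_avg _ _ _ (fun x => 2^-1 * (curie_weiss (2 * theta) A x +
  curie_weiss (2 * theta) A' x))); last by move=> x; rewrite mulrC.
have e1 : expR 4^-1 <= expR 1 :> R by rewrite ler_expR; lra.
have := avg_curie_weiss_double_le As; have := avg_curie_weiss_double_le A's.
by rewrite avgZ avgD; lra.
Qed.

(* [overlap_gain M b] is the mean over a random sign of M of
   exp (theta ((M + b)^2 - M^2)) - 1. *)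
Definition overlap_gain (M b : R) : R :=
  expR (theta * b ^+ 2) *
    ((expR (2 * theta * M * b) + expR (- (2 * theta * M * b))) / 2) - 1.

Lemma overlap_gain_ge0 M b : 0 <= overlap_gain M b.
Proof.
rewrite subr_ge0; apply: mulr_ege1.
  by apply: le_trans (expR_ge1Dx _); rewrite lerDl mulr_ge0 ?sqr_ge0.
have := expR_ge1Dx (2 * theta * M * b).
by have := expR_ge1Dx (- (2 * theta * M * b)); lra.
Qed.

Definition overlap_const (K : nat) : R := 4 * K%:R ^+ 2 * expR (K%:R ^+ 2).

Lemma overlap_const_ge0 (K : nat) : 0 <= overlap_const K.
Proof. by rewrite /overlap_const mulr_ge0 ?expR_ge0// mulr_ge0 ?sqr_ge0. Qed.

(** The bound on the hyperbolic cosine gives [expR y - 1 <= y * expR y], where [y <= K ^ 2] because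
    [theta * s <= 1/16]. The factor [expR (theta * M ^+ 2)] has to stay: [theta * s ^ 2] may be
    large, and only the average of this factor is bounded. *)
Lemma overlap_gain_le (K : nat) M b : `|M| <= s%:R -> `|b| <= K%:R ->
  overlap_gain M b <= overlap_const K * theta * expR (theta * M ^+ 2).
Proof.
move=> Ms bK; set y := theta * b ^+ 2 * (1 + 4 * (theta * M ^+ 2)).
have s1 : 1 <= s%:R :> R by rewrite ler1n.
have ts := theta_s; have t0 := theta_ge0.
have t1 : theta <= 16^-1 by nra.
have b2 : b ^+ 2 <= K%:R ^+ 2.
  by rewrite -[leLHS]real_normK ?num_real// ler_sqr ?nnegrE ?ler0n.
have M2 : M ^+ 2 <= s%:R ^+ 2.
  by rewrite -[leLHS]real_normK ?num_real// ler_sqr ?nnegrE ?ler0n.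
have tM : theta ^+ 2 * M ^+ 2 <= 256^-1.
  apply: le_trans (ler_wpM2l (sqr_ge0 theta) M2) _.
  have : 0 <= theta * s%:R by rewrite mulr_ge0.
  by rewrite -exprMn; nra.
have yK : y <= K%:R ^+ 2.
  have -> : y = b ^+ 2 * (theta + 4 * (theta ^+ 2 * M ^+ 2)).
    by rewrite /y; lra.
  apply: le_trans b2; rewrite ler_piMr ?sqr_ge0//; lra.
have y0 : 0 <= y.
  apply: mulr_ge0; first by rewrite mulr_ge0// sqr_ge0.
  apply: addr_ge0 => //; apply: mulr_ge0 => //.
  by rewrite mulr_ge0// sqr_ge0.
have -> : overlap_const K * theta * expR (theta * M ^+ 2) =
    theta * K%:R ^+ 2 * (4 * expR (theta * M ^+ 2)) * expR (K%:R ^+ 2).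
  by rewrite /overlap_const; lra.
apply: (@le_trans _ _ (expR y - 1)).
  have -> : y = theta * b ^+ 2 + (2 * theta * M * b) ^+ 2.
    by rewrite /y !exprMn; lra.
  rewrite /overlap_gain lerD2r expRD ler_pM2l ?expR_gt0//.
  by rewrite ler_pdivrMr// [leRHS]mulrC cosh_le.
apply: le_trans (expRB1_le _) _.
apply: ler_pM; rewrite ?expR_ge0 ?ler_expR//.
have e1 := expR_ge1Dx (theta * M ^+ 2).
have m0 : 0 <= theta * M ^+ 2 by rewrite mulr_ge0// sqr_ge0.
apply: ler_pM; [by rewrite mulr_ge0 ?sqr_ge0|lra| |lra].
by rewrite ler_wpM2l.
Qed.

(** Each weight splits as [U + D], with [U] the weight of the vertices outside the other set. By
    independence the terms with [U] or [U'] cancel in the covariance, leaving that of [D] and [D'].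
    Averaging over flips of the private spins makes each of these of order [theta]. *)
Lemma cov_curie_weiss_overlap_le (K : nat) A A' :
  (#|A| <= s)%N -> (#|A'| <= s)%N -> (#|A :&: A'| <= K)%N ->
  cov (curie_weiss theta A) (curie_weiss theta A')
    <= (overlap_const K * theta) ^+ 2 * expR 1.
Proof.
move=> As A's AA'.
set B := A :\: A'; set B' := A' :\: A.
pose U := curie_weiss theta B; pose U' := curie_weiss theta B'.
pose D x := curie_weiss theta A x - U x.
pose D' x := curie_weiss theta A' x - U' x.
pose g x := overlap_gain (magnet R B x) (magnet R (A :&: A') x).
pose g' x := overlap_gain (magnet R B' x) (magnet R (A :&: A') x).
have mem i : (i \in B) = (i \in A) && (i \notin A') by rewrite inE andbC.
have mem' i : (i \in B') = (i \in A') && (i \notin A) by rewrite inE andbC.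
have A'B : A' \subset ~: B.
  by apply/fintype.subsetP => i iA'; rewrite inE mem iA' andbF.
have AB' : A \subset ~: B'.
  by apply/fintype.subsetP => i iA; rewrite inE mem' iA andbF.
have BA : B \subset A by apply/fintype.subsetP => i; rewrite mem => /andP[].
have B'A' : B' \subset A'.
  by apply/fintype.subsetP => i; rewrite mem' => /andP[].
have disB (C : {set 'I_d}) : C \subset A' -> [disjoint C & B].
  by move=> CA'; rewrite finset.disjoints_subset (fintype.subset_trans CA').
have disB' (C : {set 'I_d}) : C \subset A -> [disjoint C & B'].
  by move=> CA; rewrite finset.disjoints_subset (fintype.subset_trans CA).
have IA : A :&: A' \subset A by exact: finset.subsetIl.
have IA' : A :&: A' \subset A' by exact: finset.subsetIr.
have depU : depends_on B U.
  exact: (@magnet_depends R d B B (fun m => expR (theta * m ^+ 2))).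
have depU' (C : {set 'I_d}) : B' \subset C -> depends_on C U'.
  exact: (@magnet_depends R d B' C (fun m => expR (theta * m ^+ 2))).
have depW' (C : {set 'I_d}) :
    A' \subset C -> depends_on C (curie_weiss theta A').
  exact: (@magnet_depends R d A' C (fun m => expR (theta * m ^+ 2))).
have depW (C : {set 'I_d}) : A \subset C -> depends_on C (curie_weiss theta A).
  exact: (@magnet_depends R d A C (fun m => expR (theta * m ^+ 2))).
(* The cross term [2 * theta * M * b] changes sign with [M]; averaging over the two signs produces
   [overlap_gain]. *)
have gain M b : (expR (theta * (M + b) ^+ 2) - expR (theta * M ^+ 2) +
    (expR (theta * (- M + b) ^+ 2) - expR (theta * (- M) ^+ 2))) / 2 =
    expR (theta * M ^+ 2) * overlap_gain M b.
  have -> : theta * (M + b) ^+ 2 =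
    theta * M ^+ 2 + theta * b ^+ 2 + 2 * theta * M * b by lra.
  have -> : theta * (- M + b) ^+ 2 =
    theta * M ^+ 2 + theta * b ^+ 2 + - (2 * theta * M * b) by lra.
  by rewrite sqrrN /overlap_gain !expRD; lra.
have Dsym x : (D x + D (flip B x)) / 2 = U x * g x.
  rewrite /D /U /g /curie_weiss !(magnetID _ A A') -/B.
  by rewrite magnet_flip_in// magnet_flip_out ?disB// gain.
have D'sym x : (D' x + D' (flip B' x)) / 2 = U' x * g' x.
  rewrite /D' /U' /g' /curie_weiss !(magnetID _ A' A) -/B'.
  rewrite [A' :&: A]finset.setIC.
  by rewrite magnet_flip_in// magnet_flip_out ?disB'// gain.
have D_flip x : D (flip B' x) = D x.
  by rewrite /D /U /curie_weiss !magnet_flip_out ?disB'.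
have D'_flip x : D' (flip B x) = D' x.
  by rewrite /D' /U' /curie_weiss !magnet_flip_out ?disB.
have Ug_flip x : U (flip B' x) * g (flip B' x) = U x * g x.
  by rewrite /U /g /curie_weiss !magnet_flip_out ?disB'.
have U0 x : 0 <= U x by exact/ltW/curie_weiss_gt0.
have U'0 x : 0 <= U' x by exact/ltW/curie_weiss_gt0.
have g0 x : 0 <= g x by exact: overlap_gain_ge0.
have g'0 x : 0 <= g' x by exact: overlap_gain_ge0.
have D0 : 0 <= avg D.
  rewrite (avg_symmetrize _ (flipK B)); apply: avg_ge0 => x.
  by rewrite Dsym mulr_ge0.
have D'0 : 0 <= avg D'.
  rewrite (avg_symmetrize _ (flipK B')); apply: avg_ge0 => x.
  by rewrite D'sym mulr_ge0.
(* Flipping [B] fixes [D'], and flipping [B'] fixes [U] and [g], so the two symmetrizations act on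
   separate factors. *)
have DD' : avg (fun x => D x * D' x) =
    avg (fun x => U x * g x * (U' x * g' x)).
  rewrite (avg_symmetrize _ (flipK B)).
  rewrite (@eq_avg _ _ _ (fun x => U x * g x * D' x)); last first.
    by move=> x; rewrite D'_flip -Dsym; lra.
  rewrite (avg_symmetrize _ (flipK B')); apply: eq_avg => x.
  by rewrite Ug_flip -D'sym; lra.
have iUU' : avg (fun x => U x * U' x) = avg U * avg U'.
  by apply: (avg_indep depU); apply: depU'; exact: fintype.subset_trans A'B.
have iUD' : avg (fun x => U x * D' x) = avg U * avg D'.
  apply: (avg_indep depU) => x y xy; congr (_ - _).
    exact: (depW' _ A'B).
  by apply: (depU' _ _ _ _ xy); exact: fintype.subset_trans A'B.
have iDU' : avg (fun x => D x * U' x) = avg D * avg U'.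
  rewrite (eq_avg (fun x => mulrC _ _)) mulrC.
  apply: (avg_indep (depU' _ _)) => // x y xy; congr (_ - _).
    exact: (depW _ AB').
  apply: (@magnet_depends R d B (~: B') (fun m => expR (theta * m ^+ 2))) xy.
  exact: fintype.subset_trans AB'.
have WD x : curie_weiss theta A x = U x + D x by rewrite addrC subrK.
have W'D x : curie_weiss theta A' x = U' x + D' x by rewrite addrC subrK.
clearbody D D'.
have -> : cov (curie_weiss theta A) (curie_weiss theta A') =
    avg (fun x => D x * D' x) - avg D * avg D'.
  rewrite /cov (eq_avg WD) (eq_avg W'D).
  rewrite (@eq_avg _ _ _ (fun x => U x * U' x + U x * D' x +
    (D x * U' x + D x * D' x))); last first.
    by move=> x; rewrite WD W'D mulrDl !mulrDr.
  by rewrite !avgD iUU' iUD' iDU'; lra.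
rewrite DD'; set a := overlap_const K * theta.
have B_le : (#|B| <= s)%N by apply: leq_trans As; exact: subset_leq_card.
have B'_le : (#|B'| <= s)%N by apply: leq_trans A's; exact: subset_leq_card.
apply: (@le_trans _ _ (avg (fun x => a ^+ 2 *
    (curie_weiss (2 * theta) B x * curie_weiss (2 * theta) B' x)))).
  (* The subtracted product of means is nonnegative and is dropped. *)
  rewrite lerBlDr; apply: ler_wpDr; first exact: mulr_ge0.
  apply: ler_avg => x.
  have norm_le (C : {set 'I_d}) k : (#|C| <= k)%N -> `|magnet R C x| <= k%:R.
    by move=> Ck; rewrite (le_trans (magnet_le _ _ _))// ler_nat.
  have gU : g x <= a * U x by apply: overlap_gain_le; exact: norm_le.
  have gU' : g' x <= a * U' x by apply: overlap_gain_le; exact: norm_le.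
  rewrite -!curie_weiss_sqr -/(U x) -/(U' x).
  have -> : a ^+ 2 * (U x ^+ 2 * U' x ^+ 2) =
    U x * (a * U x) * (U' x * (a * U' x)) by lra.
  by apply: ler_pM; rewrite ?mulr_ge0// ler_wpM2l.
rewrite avgZ ler_wpM2l ?sqr_ge0//.
(* [B] and [B'] are disjoint, so the mean splits into two factors, each at most [expR (4^-1)]. *)
rewrite (@avg_indep _ _ B); last first.
- apply: (@magnet_depends R d B' _ (fun m => expR (2 * theta * m ^+ 2))).
  exact: fintype.subset_trans A'B.
- exact: (@magnet_depends R d B B (fun m => expR (2 * theta * m ^+ 2))).
have h := avg_curie_weiss_double_le B_le.
have h' := avg_curie_weiss_double_le B'_le.
have p0 : 0 <= 2 * theta by rewrite mulr_ge0.
have := ler_pM (le_trans ler01 (avg_curie_weiss_ge1 B p0))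
  (le_trans ler01 (avg_curie_weiss_ge1 B' p0)) h h'.
move=> /le_trans; apply; rewrite -expRD ler_expR; lra.
Qed.

End Covariance.

(** * The second-moment argument against a single query *)

Section SecondMoment.
Variables (R : realType) (d : nat) (I : finType) (W : I -> cube d -> R).
Variables (B : {set I}) (b : I -> I -> R) (q : cube d -> R) (t v : R).

(** Let [L] be the sum over [B] of the centred likelihood ratios. Its correlation with [q] exceeds
    [t * #|B|], while its second moment is at most [v * #|B| ^ 2]; Cauchy-Schwarz concludes. *)
Lemma second_moment_bound : (0 < #|B|)%N -> 0 <= t ->
    (forall i, 1 <= avg (W i)) ->
    (forall i j, 0 <= b i j) ->
    (forall i j, cov (W i) (W j) <= b i j) ->
    (forall i, i \in B -> \sum_(j in B) b i j <= v * #|B|%:R) ->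
    (forall i, i \in B -> t < avg (fun x => q x * W i x) / avg (W i) - avg q) ->
  t ^+ 2 < v * avg (fun x => q x ^+ 2).
Proof.
move=> B0 t0 c1 b0 covb bv tB.
have c0 i : 0 < avg (W i) by exact: lt_le_trans (c1 i).
pose l i x := W i x / avg (W i) - 1.
pose L x := \sum_(i in B) l i x.
have n0 : 0 < #|B|%:R :> R by rewrite ltr0n.
have Wl i x : W i x = avg (W i) * (l i x + 1).
  by rewrite subrK mulrC divfK// gt_eqF.
have avgl i : avg (fun x => q x * l i x) =
    avg (fun x => q x * W i x) / avg (W i) - avg q.
  rewrite (@eq_avg _ _ _ (fun x => (avg (W i))^-1 * (q x * W i x) - q x)).
    by rewrite avgB avgZ mulrC.
  by move=> x; rewrite /l mulrBr mulr1 mulrA mulrC.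
have lower : t * #|B|%:R < avg (fun x => q x * L x).
  rewrite (@eq_avg _ _ _ (fun x => \sum_(i in B) q x * l i x)); last first.
    by move=> x; rewrite mulr_sumr.
  rewrite avg_sum mulr_natr -sumr_const.
  have [i iB] := card_gt0P B0.
  rewrite (bigD1 i)//= [ltRHS](bigD1 i)//=; apply: ltr_leD.
    by rewrite avgl tB.
  by apply: ler_sum => j /andP[jB _]; rewrite avgl ltW// tB.
have upper : avg (fun x => L x ^+ 2) <= v * #|B|%:R * #|B|%:R.
  rewrite (@eq_avg _ _ _
    (fun x => \sum_(i in B) \sum_(j in B) l i x * l j x)); last first.
    by move=> x; rewrite expr2 /L mulr_suml; apply: eq_bigr => i _;
      rewrite mulr_sumr.
  rewrite avg_sum mulr_natr -sumr_const; apply: ler_sum => i iB.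
  apply: le_trans _ (bv i iB); rewrite avg_sum; apply: ler_sum => j jB.
  have -> : avg (fun x => l i x * l j x) =
      cov (W i) (W j) * (avg (W i) * avg (W j))^-1.
    have -> : cov (W i) (W j) =
        avg (fun x => avg (W i) * avg (W j) * (l i x * l j x)).
      rewrite (@eq_avg _ _ _ (fun x => W i x * W j x - avg (W j) * W i x
          - (avg (W i) * W j x - avg (W i) * avg (W j)))).
        by rewrite !avgB (avg_cst d (_ * _)) !avgZ /cov; lra.
      by move=> x; rewrite (Wl i) (Wl j); lra.
    by rewrite avgZ mulrC mulKf// gt_eqF// mulr_gt0.
  have cc0 : 0 < avg (W i) * avg (W j) by exact: mulr_gt0.
  (* Dividing by means that are at least 1 shrinks a positive covariance; a negative one is below
     [b i j] anyway. *)
  have [cv|/ltW cv] := leP 0 (cov (W i) (W j)).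
    apply: le_trans (covb i j); rewrite ler_piMr// invf_le1//.
    exact: mulr_ege1.
  apply: le_trans (b0 i j); rewrite mulr_le0_ge0//.
  by rewrite invr_ge0 ltW.
have q0 : 0 <= avg (fun x => q x ^+ 2).
  by apply: avg_ge0 => x; exact: sqr_ge0.
have CS := avg_CauchySchwarz q L.
rewrite -(ltr_pM2r (exprn_gt0 2 n0)) -exprMn.
have : (t * #|B|%:R) ^+ 2 < avg (fun x => q x * L x) ^+ 2.
  have tB0 : 0 <= t * #|B|%:R by rewrite mulr_ge0// ltW.
  by rewrite ltr_sqr ?nnegrE// ltW// (le_lt_trans tB0).
move=> /lt_le_trans; apply; apply: le_trans CS _.
apply: le_trans (ler_wpM2l q0 upper) _; lra.
Qed.

End SecondMoment.

(** * Overlaps of random transversals *)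

Section Transversals.
Variables (R : realType) (s m : nat).
Implicit Types f g : {ffun 'I_s -> 'I_m}.

Definition agree f g : nat := #|[set j | f j == g j]|.

(** The generating function factors over the blocks: in each, one value agrees with [f] and
    contributes [t], the [m - 1] others contribute 1. *)
Lemma sum_exp_agree f (t : R) :
  \sum_g t ^+ agree f g = (m%:R - 1 + t) ^+ s.
Proof.
rewrite (eq_bigr (fun g : {ffun 'I_s -> 'I_m} =>
    \prod_j (if f j == g j then t else 1))); last first.
  move=> g _; rewrite -big_mkcond/= prodr_const; congr (_ ^+ _).
  by apply: eq_card => j; rewrite !inE.
rewrite -(bigA_distr_bigA (fun j v => if f j == v then t else 1))/=.
rewrite (eq_bigr (fun=> m%:R - 1 + t)) ?prodr_const ?card_ord// => j _.
rewrite (bigD1 (f j))//= eqxx addrC; congr (_ + _).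
rewrite (eq_bigr (fun=> 1)); last by move=> v; rewrite eq_sym => /negbTE ->.
rewrite sumr_const cardC1 card_ord; case: m f => [|m'] f.
  by case: (f j).
by rewrite /= -natr1 addrK.
Qed.

(** Markov's inequality for [t ^+ agree f g] at [t = m / s], where [(m - 1 + t) ^ s <= m ^ s * (1 +
    1 / s) ^ s]. *)
Lemma card_agree_le f (k : nat) : (0 < s)%N -> (s <= m)%N ->
  #|[set g | (k <= agree f g)%N]|%:R * m%:R ^+ k
    <= expR 1 * m%:R ^+ s * s%:R ^+ k :> R.
Proof.
move=> s0 sm; have sR : 0 < s%:R :> R by rewrite ltr0n.
have smR : s%:R <= m%:R :> R by rewrite ler_nat.
pose t : R := m%:R / s%:R.
have t1 : 1 <= t by rewrite ler_pdivlMr// mul1r.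
have : #|[set g | (k <= agree f g)%N]|%:R * t ^+ k <= (m%:R - 1 + t) ^+ s.
  rewrite -(sum_exp_agree f) mulr_natl -sumr_const.
  rewrite [leLHS]big_mkcond/=; apply: ler_sum => g _.
  rewrite inE; case: ifP => kg; first by rewrite ler_weXn2l.
  by rewrite exprn_ge0// (le_trans ler01).
have : (m%:R - 1 + t) ^+ s <= expR 1 * m%:R ^+ s.
  have -> : expR 1 = expR (s%:R^-1) ^+ s :> R.
    by rewrite -expRM_natl divff// gt_eqF.
  rewrite -exprMn; apply: lerXn2r; rewrite ?nnegrE.
  - by rewrite addr_ge0 ?(le_trans ler01 t1)// subr_ge0 ler1n (leq_trans s0).
  - by rewrite mulr_ge0// expR_ge0.
  apply: le_trans (ler_wpM2r (ler0n _ _) (expR_ge1Dx _)).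
  by rewrite /t mulrDl mul1r [_^-1 * _]mulrC; lra.
move=> h1 h2; have := le_trans h2 h1.
rewrite /t expr_div_n mulrA ler_pdivrMr ?exprn_gt0//.
Qed.

Variables (d : nat) (phi : 'I_s * 'I_m -> 'I_d).
Hypothesis phi_inj : injective phi.

Definition transversal_set f : {set 'I_d} := [set phi (j, f j) | j : 'I_s].

Lemma card_transversal_set f : #|transversal_set f| = s.
Proof. by rewrite card_imset ?card_ord// => i j /phi_inj[]. Qed.

Lemma card_transversal_setI f g :
  (#|transversal_set f :&: transversal_set g| <= agree f g)%N.
Proof.
rewrite /agree.
rewrite -(@card_imset _ _ (fun j => phi (j, f j)) (mem [set j | f j == g j]));
  last by move=> i j /phi_inj[].
apply/subset_leq_card/fintype.subsetP => x; rewrite inE => /andP[].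
move=> /imsetP[i _ ->] /imsetP[j _ /phi_inj[ij fg]].
by apply/imsetP; exists i; rewrite ?inE// fg ij.
Qed.

End Transversals.

(** * Ising laws of cliques and norms of queries under them *)

Section Clique.
Variables (R : realType) (d : nat).
Implicit Types (A : {set 'I_d}) (x : cube d) (theta : R).

Definition clique theta A : 'M[R]_d :=
  \matrix_(i, j) (if [&& i != j, i \in A & j \in A] then theta else 0).

(** Expanding the squared magnetization over ordered pairs, the diagonal adds [#|A|] since spins
    square to 1. *)
Lemma ising_weight_clique theta A x :
  ising_weight (clique theta A) x
    = curie_weiss theta A x * expR (- (theta * #|A|%:R)).
Proof.
rewrite /curie_weiss -expRD; congr expR.
rewrite (eq_bigr (fun i => \sum_(j in A)
    (if i \in A then theta * (spin R x i * spin R x j) else 0)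
    - (if i \in A then theta else 0))); last first.
  move=> i _; case: (boolP (i \in A)) => iA; last first.
    rewrite subr0 !big1// => j _.
    by rewrite mxE (negbTE iA) andbF !mul0r.
  rewrite (bigD1 i)//= [in RHS](bigD1 i)//= mxE eqxx !mul0r add0r.
  rewrite -expr2 spin_sqr mulr1 addrAC subrr add0r.
  rewrite [LHS](bigID (mem A))/= [X in _ + X]big1 ?addr0; last first.
    by move=> j /andP[_ jA]; rewrite mxE (negbTE jA) !andbF !mul0r.
  apply: eq_big => [j|j /andP[ji jA]]; first by rewrite andbC.
  by rewrite mxE eq_sym ji iA jA mulrA.
rewrite sumrB; congr (_ - _); last first.
  by rewrite -big_mkcond/= sumr_const mulr_natr.
rewrite exprS expr1 /magnet mulr_suml mulr_sumr [RHS]big_mkcond/=.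
apply: eq_bigr => i _; case: ifP => _; last by rewrite big1.
by rewrite 2!mulr_sumr.
Qed.

Lemma mean_clique theta A (f : cube d -> R) :
  mean (ising (clique theta A)) f
    = avg (fun x => f x * curie_weiss theta A x) / avg (curie_weiss theta A).
Proof.
rewrite /mean /= /avg invfM mulrACA divff ?mul1r; last first.
  by rewrite invr_eq0 gt_eqF// card_cube_gt0.
have -> : ising_Z (clique theta A) =
    (\sum_x curie_weiss theta A x) * expR (- (theta * #|A|%:R)).
  by rewrite /ising_Z (eq_bigr _ (fun x _ => ising_weight_clique theta A x))
    mulr_suml.
rewrite [RHS]mulr_suml; apply: eq_bigr => x _.
rewrite ising_weight_clique invfM mulrACA divff ?mulr1; last first.
  by rewrite gt_eqF// expR_gt0.
by rewrite mulrC mulrA.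
Qed.

Lemma mean_ising0 (f : cube d -> R) : mean (ising 0) f = avg f.
Proof.
have -> : 0 = clique 0 finset.set0.
  by apply/matrixP => i j; rewrite !mxE; case: ifP.
rewrite mean_clique.
have c1 x : curie_weiss (0 : R) finset.set0 x = 1.
  by rewrite /curie_weiss mul0r expR0.
by rewrite (eq_avg c1) avg_cst divr1; apply: eq_avg => x; rewrite c1 mulr1.
Qed.

Lemma mean_ge0 (P : law R d) (f : cube d -> R) :
  (forall x, 0 <= f x) -> 0 <= mean P f.
Proof. by move=> f0; apply: sumr_ge0 => x _; rewrite mulr_ge0// law_ge0. Qed.

Lemma psi1_ge_moment4 (P : law R d) (q : cube d -> R) (u : R) : 0 <= u ->
  u ^+ 4 <= mean P (fun x => q x ^+ 4) -> ((u / 4)%:E <= psi1 P q)%E.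
Proof.
move=> u0 um.
apply: (@le_trans _ _ (4^-1 * mean P (fun x => `|q x| `^ 4) `^ 4^-1)%:E).
  rewrite lee_fin mulrC ler_wpM2l//.
  rewrite (_ : u = (u ^+ 4) `^ 4^-1); last first.
    by rewrite -powR_mulrn// -powRrM mulfV ?pnatr_eq0// powRr1.
  apply: ge0_ler_powR; rewrite ?nnegrE ?exprn_ge0//.
    by apply: mean_ge0 => x; exact: powR_ge0.
  apply: le_trans um _; apply: ler_sum => x _; rewrite ler_wpM2l ?law_ge0//.
  by rewrite powR_mulrn// -[leRHS]normrX ler_norm.
by apply: ereal_sup_ubound; exists 4 => //=; rewrite ler1n.
Qed.

Lemma psi1_ge0 (P : law R d) (q : cube d -> R) : (0 <= psi1 P q)%E.
Proof.
apply: le_trans (@psi1_ge_moment4 P q 0 _ _) => //; rewrite ?mul0r//.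
by rewrite expr0n; apply: mean_ge0 => x; rewrite exprn_even_ge0.
Qed.

(* Reverse Hoelder: the L2 norm under the null law is controlled by the L4 norm
   under the alternative because 1 / curie_weiss is at most 1. *)
Lemma psi1_clique_ge theta (s : nat) A (q : cube d -> R) :
  0 <= theta -> (0 < s)%N -> 16 * theta * s%:R <= 1 -> (#|A| <= s)%N ->
  ((Num.sqrt (avg (fun x => q x ^+ 2)) / 8)%:E
     <= psi1 (ising (clique theta A)) q)%E.
Proof.
move=> t0 s0 ts As; set N := Num.sqrt _.
have q2 : 0 <= avg (fun x => q x ^+ 2) by apply: avg_ge0 => x; exact: sqr_ge0.
have N0 : 0 <= N by exact: sqrtr_ge0.
(* The 4 is the order of the moment used; the 2 absorbs the normalization [avg W <= 4]. *)
have -> : N / 8 = (N / 2) / 4 by lra.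
apply: psi1_ge_moment4; first by rewrite divr_ge0.
have N4 : N ^+ 4 = avg (fun x => q x ^+ 2) ^+ 2.
  by rewrite (exprM _ 2 2) sqr_sqrtr.
rewrite expr_div_n N4 mean_clique.
set W := curie_weiss theta A.
have W1 : 1 <= avg W by exact: avg_curie_weiss_ge1.
have W0 : 0 < avg W by exact: lt_le_trans W1.
have We : avg W <= 4.
  apply: le_trans (expR1_le4 R).
  apply: le_trans (avg_curie_weiss_le _ _) _ => //.
    by rewrite -(ler_nat R) in As; nra.
  by rewrite ler_expR; rewrite -(ler_nat R) in As; nra.
(* The square root of the weight: Cauchy-Schwarz is applied to [q ^+ 2 * r] and [1 / r]. *)
pose r x := expR (theta * magnet R A x ^+ 2 / 2).
have r0 x : r x != 0 by rewrite gt_eqF// expR_gt0.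
have rW x : r x ^+ 2 = W x by rewrite /r -expRM_natl /W; congr expR; lra.
have CS := avg_CauchySchwarz (fun x => q x ^+ 2 * r x) (fun x => (r x)^-1).
rewrite /= in CS.
have E1 : avg (fun x => q x ^+ 2 * r x / r x) = avg (fun x => q x ^+ 2).
  by apply: eq_avg => x; rewrite mulfK.
have E2 : avg (fun x => (q x ^+ 2 * r x) ^+ 2) = avg (fun x => q x ^+ 4 * W x).
  by apply: eq_avg => x; rewrite exprMn rW -exprM.
rewrite {}E1 {}E2 in CS.
have inv1 : avg (fun x => (r x)^-1 ^+ 2) <= 1.
  rewrite -[leRHS](avg_cst d); apply: ler_avg => x.
  rewrite exprVn rW invf_le1 ?curie_weiss_gt0//.
  exact: curie_weiss_ge1.
have m0 : 0 <= avg (fun x => q x ^+ 4 * W x).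
  apply: avg_ge0 => x.
  by rewrite mulr_ge0 ?exprn_even_ge0// ltW// curie_weiss_gt0.
rewrite ler_pdivlMr//; apply: le_trans (le_trans CS (ler_piMr m0 inv1)).
by rewrite mulrAC -mulrA ler_piMr ?sqr_ge0// mulrC; lra.
Qed.

End Clique.

(** * A transversal that defeats a whole list of queries *)

Section Indistinguishable.
Variables (R : realType) (d s m K : nat) (phi : 'I_s * 'I_m -> 'I_d).
Variable theta : R.

(** Its square dominates the factor [a ^+ 2 * e + e] of the variance bound, with [a] the overlap
    constant: the first term stems from small overlaps, the second from large ones. *)
Definition distinguish_const : R := (overlap_const R K + 1) * expR 1.

Lemma distinguish_const_gt0 : 0 < distinguish_const.
Proof. by rewrite mulr_gt0 ?expR_gt0// ltr_wpDl// overlap_const_ge0. Qed.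

Definition shift (q : cube d -> R) (f : {ffun 'I_s -> 'I_m}) : R :=
  mean (ising (clique theta (transversal_set phi f))) q - mean (ising 0) q.

(** One-sided, because the second-moment argument adds deviations of equal sign; the other side is
    reached through [- q]. *)
Definition distinguished (q : cube d -> R) : {set {ffun 'I_s -> 'I_m}} :=
  [set f | theta * distinguish_const * Num.sqrt (avg (fun x => q x ^+ 2))
             < shift q f].

Lemma shiftN q f : shift (fun x => - q x) f = - shift q f.
Proof.
have N P : mean P (fun x => - q x) = - mean P q :> R.
  by rewrite /mean -sumrN; apply: eq_bigr => x _; rewrite mulrN.
by rewrite /shift !N opprD.
Qed.

(** A larger family would contradict [second_moment_bound]: pairs agreeing in at most [K] blocks
    have covariance of order [theta ^+ 2], and the others are too rare within the family for their
    factor [s ^ 4] to matter. *)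
Lemma card_distinguished_lt (T : nat) (q : cube d -> R) :
  injective phi -> 0 <= theta -> (0 < s)%N -> (s <= m)%N ->
  16 * theta * s%:R <= 1 -> (0 < T)%N ->
  2 * T%:R * expR 1 * s%:R ^+ K.+1 * s%:R ^+ 4 <= m%:R ^+ K.+1 :> R ->
  (2 * T * #|distinguished q| < m ^ s)%N.
Proof.
move=> phi_inj t0 s0 sm ts T0 Km; rewrite ltnNge; apply/negP => many.
set B := distinguished q in many.
have m0 : (0 < m)%N by exact: leq_trans sm.
have B0 : (0 < #|B|)%N.
  rewrite lt0n; apply/eqP => B0; move: many.
  by rewrite B0 muln0 leqn0 expn_eq0 eqn0Ngt m0.
set a := overlap_const R K; set e := expR (1 : R).
have e0 : 0 < e by exact: expR_gt0.
have e1 : 1 <= e by rewrite -expR0 ler_expR.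
have a0 : 0 <= a by exact: overlap_const_ge0.
pose W (f : {ffun 'I_s -> 'I_m}) := curie_weiss theta (transversal_set phi f).
pose small (f g : {ffun 'I_s -> 'I_m}) : R :=
  if (agree f g <= K)%N then (a * theta) ^+ 2 * e else 0.
pose large (f g : {ffun 'I_s -> 'I_m}) : R :=
  if (K < agree f g)%N then (theta * s%:R ^+ 2) ^+ 2 * e else 0.
have small0 f g : 0 <= small f g.
  by rewrite /small; case: ifP => // _; rewrite mulr_ge0 ?sqr_ge0// ltW.
have large0 f g : 0 <= large f g.
  by rewrite /large; case: ifP => // _; rewrite mulr_ge0 ?sqr_ge0// ltW.
have cardS f : (#|transversal_set phi f| <= s)%N.
  by rewrite card_transversal_set.
have covb f g : cov (W f) (W g) <= small f g + large f g.
  rewrite /small /large ltnNge; case: leqP => fg /=.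
    rewrite addr0; apply: (cov_curie_weiss_overlap_le t0 s0 ts) => //.
    exact: leq_trans (card_transversal_setI phi_inj f g) fg.
  by rewrite add0r; apply: cov_curie_weiss_le.
pose v := theta ^+ 2 * (a ^+ 2 * e + e).
(* The count is at most [e * m ^ s * (s / m) ^ K.+1], and [m ^ s] is at most [2 * T * #|B|]; [Km]
   absorbs the remaining factors. *)
have few (f : {ffun 'I_s -> 'I_m}) :
    #|[set g | (K < agree f g)%N]|%:R * s%:R ^+ 4 <= #|B|%:R :> R.
  have := @card_agree_le R s m f K.+1 s0 sm; set c := #|_|%:R => cm.
  have manyR : m%:R ^+ s <= 2 * T%:R * #|B|%:R :> R.
    by rewrite -natrX -!natrM ler_nat.
  have mK0 : 0 < 2 * T%:R * m%:R ^+ K.+1 :> R.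
    by rewrite !mulr_gt0 ?exprn_gt0 ?ltr0n.
  rewrite -(ler_pM2r mK0).
  have s4 : 0 <= 2 * T%:R * s%:R ^+ 4 :> R by rewrite !mulr_ge0 ?exprn_ge0.
  have ms0 : 0 <= m%:R ^+ s :> R by rewrite exprn_ge0.
  have mk0 : 0 <= m%:R ^+ K.+1 :> R by rewrite exprn_ge0.
  have h1 := ler_wpM2r s4 cm; have h2 := ler_wpM2l ms0 Km.
  have h3 := ler_wpM2r mk0 manyR.
  move: h1 h2 h3; rewrite -/e.
  move: (m%:R ^+ s) (m%:R ^+ K.+1) (s%:R ^+ 4) (s%:R ^+ K.+1) => ms mk sf sk.
  by lra.
have bv f : f \in B -> \sum_(g in B) (small f g + large f g) <= v * #|B|%:R.
  move=> _; rewrite big_split/= /v mulrDr mulrDl; apply: lerD.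
    rewrite mulr_natr -sumr_const; apply: ler_sum => g _; rewrite /small.
    case: ifP => _; first by lra.
    by rewrite mulr_ge0 ?sqr_ge0// mulr_ge0 ?sqr_ge0// ltW.
  have te0 : 0 <= theta ^+ 2 * e by rewrite mulr_ge0 ?sqr_ge0// ltW.
  apply: le_trans _ (ler_wpM2l te0 (few f)).
  apply: (@le_trans _ _ (\sum_g large f g)).
    by rewrite [leLHS]big_mkcond/=; apply: ler_sum => g _; case: ifP.
  rewrite /large -big_mkcond/= sumr_const.
  rewrite (eq_card (B := mem [set g | (K < agree f g)%N])); last first.
    by move=> g; rewrite !inE.
  rewrite -mulr_natl; lra.
have tB f : f \in B ->
    theta * distinguish_const * Num.sqrt (avg (fun x => q x ^+ 2))
      < avg (fun x => q x * W f x) / avg (W f) - avg q.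
  by rewrite inE /shift mean_clique mean_ising0.
have D0 := ltW distinguish_const_gt0.
have b0 f g : 0 <= small f g + large f g by exact: addr_ge0.
have c1 f : 1 <= avg (W f) by exact: avg_curie_weiss_ge1.
have tD0 := mulr_ge0 (mulr_ge0 t0 D0) (sqrtr_ge0 (avg (fun x => q x ^+ 2))).
have := second_moment_bound B0 tD0 c1 b0 covb bv tB.
rewrite exprMn sqr_sqrtr; last by apply: avg_ge0 => x; exact: sqr_ge0.
apply/negP; rewrite -leNgt ler_wpM2r//.
  by apply: avg_ge0 => x; exact: sqr_ge0.
rewrite /v [(_ * distinguish_const) ^+ 2]exprMn ler_wpM2l ?sqr_ge0//.
rewrite /distinguish_const -/a -/e.
have ee : 0 <= e * (e - 1) by rewrite mulr_ge0 ?subr_ge0// ltW.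
have p1 := mulr_ge0 (sqr_ge0 a) ee; have p2 := mulr_ge0 a0 (sqr_ge0 e).
lra.
Qed.

(** A union bound over the queries [q k] and their opposites, each distinguishing a proportion below
    [1 / (2 * T)]. *)
Lemma exists_indistinguishable (T : nat) (q : 'I_T -> cube d -> R) :
  injective phi -> 0 <= theta -> (0 < s)%N -> (s <= m)%N ->
  16 * theta * s%:R <= 1 ->
  2 * T%:R * expR 1 * s%:R ^+ K.+1 * s%:R ^+ 4 <= m%:R ^+ K.+1 :> R ->
  exists f : {ffun 'I_s -> 'I_m}, forall k,
    `|shift (q k) f|
      <= theta * distinguish_const * Num.sqrt (avg (fun x => q k x ^+ 2)).
Proof.
move=> phi_inj t0 s0 sm ts Km.
case: (pickP (fun f : {ffun 'I_s -> 'I_m} => [forall k, `|shift (q k) f|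
    <= theta * distinguish_const * Num.sqrt (avg (fun x => q k x ^+ 2))])).
  by move=> f /forallP qf; exists f.
move=> bad; exfalso.
have m0 : (0 < m)%N by exact: leq_trans sm.
pose D k := distinguished (q k) :|: distinguished (fun x => - q k x).
have cover f : exists k, f \in D k.
  have /negbT := bad f; rewrite negb_forall => /existsP[k].
  rewrite -ltNge lter_normr => fk; exists k; rewrite !inE shiftN.
  by under [X in _ || (_ * Num.sqrt X < _)]eq_avg do rewrite sqrrN.
(* Some transversal exists, and the query that catches it shows that the list is nonempty. *)
have T0 : (0 < T)%N.
  have [[k /= kT] _] := cover [ffun=> Ordinal m0]; exact: leq_ltn_trans kT.
have cD k : (T * #|D k| < m ^ s)%N.
  have h := card_distinguished_lt (q k) phi_inj t0 s0 sm ts T0 Km.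
  have h' := card_distinguished_lt (fun x => - q k x) phi_inj t0 s0 sm ts T0 Km.
  have : (#|D k| <= #|distinguished (q k)| +
      #|distinguished (fun x => (- q k x)%R)|)%N.
    by rewrite cardsU leq_subr.
  nia.
have : (m ^ s <= \sum_k #|D k|)%N.
  have <- : #|{: {ffun 'I_s -> 'I_m}}| = (m ^ s)%N.
    by rewrite card_ffun !card_ord.
  rewrite -sum1_card (eq_bigr (fun k => \sum_(f | f \in D k) 1)%N); last first.
    by move=> k _; rewrite sum1_card.
  rewrite (exchange_big_dep xpredT)//=; apply: leq_sum => f _.
  by have [k fk] := cover f; rewrite (bigD1 k).
have : (\sum_k T * #|D k| <= \sum_(k < T) (m ^ s).-1)%N.
  by apply: leq_sum => k _; have := cD k; lia.
rewrite -big_distrr/= sum_nat_const card_ord.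
have ms : (0 < m ^ s)%N by rewrite expn_gt0 m0.
nia.
Qed.

End Indistinguishable.

(** * Injections between finite vertex sets *)

Section Embeddings.
Variable d : nat.

Lemma exists_injection (s m : nat) : (s * m <= d)%N ->
  exists phi : 'I_s * 'I_m -> 'I_d, injective phi.
Proof.
move=> smd; have c : (#|{: 'I_s * 'I_m}| <= d)%N by rewrite card_prod !card_ord.
by exists (fun p => widen_ord c (enum_rank p)) => p p' /(congr1 val)/=
  /val_inj/enum_rank_inj.
Qed.

(** Each set is listed before its complement; matching positions in the two lists sends [V] to
    [A]. *)
Lemma exists_injection_onto (V A : {set 'I_d}) : #|V| = #|A| ->
  exists2 f : 'I_d -> 'I_d, injective f & forall i, i \in V -> f i \in A.
Proof.
move=> VA.
pose u (X : {set 'I_d}) := enum X ++ enum (~: X).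
have memu X i : i \in u X by rewrite mem_cat !mem_enum inE orbN.
have uniqu X : uniq (u X).
  rewrite cat_uniq !enum_uniq/= andbT; apply/hasPn => i.
  by rewrite !mem_enum inE.
have sizeu X : size (u X) = d by rewrite size_cat -!cardE cardsC card_ord.
exists (fun i => nth i (u A) (index i (u V))) => [i j|i iV].
  have ij k : (index k (u V) < size (u A))%N 
    by have := memu V k; rewrite -index_mem !sizeu.
  rewrite (set_nth_default i j)// => /eqP; rewrite nth_uniq// => /eqP.
  by move=> /(congr1 (nth i (u V))); rewrite !nth_index.
have iV' : (index i (u V) < #|A|)%N.
  by rewrite -VA cardE index_cat mem_enum iV index_mem mem_enum.
by rewrite nth_cat -cardE iV' -mem_enum mem_nth// -cardE.
Qed.

End Embeddings.

(** * Cliques as admissible signals *)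

Section Signals.
Variables (R : realType) (d : nat) (Gstar : rel 'I_d) (theta : R).

(** Edges of [Gstar] join non-isolated vertices, which an injection sends into [A], where all edges
    are present. The Frobenius norm is at most [theta * #|A|]. *)
Lemma clique_signals (A : {set 'I_d}) : simple_graph Gstar ->
  #|nonisolated Gstar| = #|A| -> 0 < theta -> 16 * theta * #|A|%:R <= 1 ->
  signals (G1 Gstar) theta (clique theta A).
Proof.
move=> [Gsym Girr] cG t0 tA.
have gE i j : graph_of (clique theta A) i j = [&& i != j, i \in A & j \in A].
  by rewrite /graph_of /= mxE; case: ifP => _; [rewrite gt_eqF|rewrite eqxx].
have sym i j : clique theta A i j = clique theta A j i.
  by rewrite !mxE eq_sym [(i \in A) && _]andbC.
split.
- by apply/matrixP => i j; rewrite [RHS]mxE sym.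
- by move=> i; rewrite mxE eqxx.
- split; first split.
  + by move=> i j; rewrite /graph_of /= sym.
  + by move=> i; rewrite gE eqxx.
  have [f finj fA] := exists_injection_onto cG.
  exists f => // i j Gij; rewrite gE (inj_eq finj) !fA ?andbT.
  + by apply/eqP => ij; rewrite ij Girr in Gij.
  + by rewrite inE; apply/existsP; exists i; rewrite Gsym.
  + by rewrite inE; apply/existsP; exists j.
- have h : 0 <= 1 / 2 :> R by lra.
  rewrite -(ger0_norm h) -sqrtr_sqr ler_sqrt ?sqr_ge0//.
  have -> : \sum_i \sum_j clique theta A i j ^+ 2 =
      \sum_i \sum_(j in A) (if (i != j) && (i \in A) then theta ^+ 2 else 0).
    apply: eq_bigr => i _; rewrite [RHS]big_mkcond/=; apply: eq_bigr => j _.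
    rewrite mxE andbA andbC; case: (j \in A) => /=; last by rewrite expr0n.
    by case: ifP => // _; rewrite expr0n.
  apply: (@le_trans _ _ (\sum_(i in A) \sum_(j in A) theta ^+ 2)).
    rewrite [leRHS]big_mkcond/=; apply: ler_sum => i _.
    case: ifPn => iA; last by rewrite big1// => j _; rewrite andbF.
    by apply: ler_sum => j _; case: ifP => // _; exact: sqr_ge0.
  rewrite !sumr_const -[leLHS]mulr_natr -[X in X * _]mulr_natr.
  have : 0 <= theta * #|A|%:R by rewrite mulr_ge0// ltW.
  by nra.
- by move=> i j; rewrite gE mxE => ->.
Qed.

End Signals.

Local Open Scope classical_set_scope.
Local Open Scope ring_scope.

(** * The adversarial oracle and the bounds on the risk *)

Section Oracles.
Variables (R : realType) (d : nat).
Implicit Types (Q : set (query R d)) (P : law R d).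

(** On a one-point probability space answers are deterministic and all events measurable. *)
Definition det_oracle Q (z : law R d -> Q -> R) : oracle Q :=
  fun P => RandomMap (@dirac _ unit tt R : probability unit R) (fun=> z P).

Lemma tau_anti (n : nat) (c x y : R) : 0 <= x -> x <= y -> y < 1 -> 0 < y ->
  (tau n c y <= tau n c x)%E.
Proof.
move=> x0 xy y1 y0; rewrite /tau (gt_eqF y0).
case: eqP => [_|/eqP xn0]; first by rewrite leey.
have x_gt0 : 0 < x by rewrite lt_def xn0.
have ln_le : c + ln (1 / y) <= c + ln (1 / x).
  by rewrite lerD2l ler_ln ?posrE ?divr_gt0// !div1r lef_pV2.
have n0 : 0 <= n%:R^-1 :> R by rewrite invr_ge0.
rewrite lee_fin ge_max !le_max; apply/andP; split.
  by rewrite ler_wpM2r.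
by apply/orP; right; apply: ler_wsqrtr; rewrite ler_wpM2r// ler_wpM2l.
Qed.

(** The square-root branch suffices: [ln 2 >= 1/2], so [2 * (c + ln 2) >= 1]. *)
Lemma tau_half_ge (n : nat) (c : R) : 0 <= c ->
  ((Num.sqrt (1 / n%:R))%:E <= tau n c (1 / 2))%E.
Proof.
move=> c0; rewrite /tau gt_eqF; last by lra.
rewrite lee_fin le_max; apply/orP; right; apply: ler_wsqrtr.
rewrite ler_wpM2r ?invr_ge0//.
have -> : ln (1 / (1 / 2)) = - ln (1 + - (1 / 2)) :> R.
  by rewrite -lnV ?posrE; [rewrite div1r; congr (ln _^-1)|]; lra.
by have := @le_ln1Dx R (- (1 / 2)) ltac:(lra); lra.
Qed.

Lemma tau_ge0 (n : nat) (c x : R) : (0 <= tau n c x)%E.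
Proof.
rewrite /tau; case: ifP => _; first by rewrite leey.
by rewrite lee_fin le_max sqrtr_ge0 orbT.
Qed.

(* The adversarial oracle answers as if the null law were true whenever this is
   accurate at every tail probability below 1/2; at larger ones the guarantee
   is void. *)
Definition null_answer (n : nat) (c : R) Q P (q : Q) : R :=
  if `[< (`|mean (ising 0) (\val q) - mean P (\val q)|%:E
            <= psi1 P (\val q) * tau n c (1 / 2))%E >]
  then mean (ising 0) (\val q) else mean P (\val q).

Lemma null_answer0 (n : nat) (c : R) Q (q : Q) :
  null_answer n c (ising 0) q = mean (ising 0) (\val q).
Proof. by rewrite /null_answer; case: ifP. Qed.

Lemma null_oracle_valid (cap : set (query R d) -> R) (n : nat) Q :
  is_oracle cap n (det_oracle (@null_answer n (cap Q) Q)).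
Proof.
move=> P xi /andP[xi0 xi1] good; split=> //.
have [xi2|xi2] := leP xi (1 / 2); last first.
  by apply: (@le_trans _ _ 0%E); rewrite ?measure_ge0// lee_fin; lra.
have -> : good = setT.
  apply/seteqP; split => // w _ q /=; rewrite /null_answer.
  case: asboolP => [acc|_].
    apply: le_trans acc _; apply: lee_wpmul2l; first exact: psi1_ge0.
    by apply: tau_anti; lra.
  by rewrite subrr normr0 mule_ge0 ?psi1_ge0 ?tau_ge0.
by rewrite probability_setT lee_fin; lra.
Qed.

Lemma rounds_prefix Q (delta : seq (Q * R) -> option Q) (z : Q -> R) k h :
  exists2 h', rounds delta z k h = h ++ h' & (size h' <= k)%N.
Proof.
elim: k h => [|k IH] h /=; first by exists [::]; rewrite ?cats0.
case: (delta h) => [q|]; last by exists [::]; rewrite ?cats0.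
have [h' -> h'k] := IH (rcons h (q, z q)).
by exists ((q, z q) :: h'); rewrite ?cat_rcons.
Qed.

(** Each query is a function of the history, so agreement of the answers along the first run alone
    forces both runs to coincide. [q0] is only the default of [nth]. *)
Lemma eq_rounds Q (delta : seq (Q * R) -> option Q) (z z' : Q -> R) q0 k h :
  (forall i, (i < size (rounds delta z k h))%N ->
     let q := nth q0 (unzip1 (rounds delta z k h)) i in z q = z' q) ->
  rounds delta z k h = rounds delta z' k h.
Proof.
elim: k h => [//|k IH] h /=; case: (delta h) => [q|//] zz'.
have [h' E _] := rounds_prefix delta z k (rcons h (q, z q)).
have <- : z q = z' q.
  have := zz' (size h); rewrite E cat_rcons size_cat /unzip1 map_cat/=.
  by rewrite nth_cat size_map ltnn subnn/= -addSnnS leq_addr; exact.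
exact: IH.
Qed.

Lemma size_transcript (A : algorithm R d) (z : alg_Q A -> R) :
  (size (transcript z) <= alg_T A)%N.
Proof.
rewrite /transcript; case: (alg_T A) => [//|k].
by have [h' -> h'k] := rounds_prefix (@alg_delta _ _ A) z k
  [:: (alg_init A, z (alg_init A))].
Qed.

Lemma eq_transcript (A : algorithm R d) (z z' : alg_Q A -> R) :
  (forall i, (i < size (transcript z))%N ->
     let q := nth (alg_init A) (unzip1 (transcript z)) i in z q = z' q) ->
  transcript z = transcript z'.
Proof.
rewrite /transcript; case: (alg_T A) => [//|k] zz'.
have [h' E _] := rounds_prefix (@alg_delta _ _ A) z k
  [:: (alg_init A, z (alg_init A))].
have <- : z (alg_init A) = z' (alg_init A) by have := zz' 0; rewrite E; exact.
exact: eq_rounds zz'.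
Qed.

(** Equal transcripts give one verdict under both laws, a sure error under one of them. *)
Lemma total_error_ge1 (A : algorithm R d) (z : law R d -> alg_Q A -> R)
    (S : set 'M[R]_d) Theta : S Theta ->
    transcript (z (ising 0)) = transcript (z (ising Theta)) ->
  (1 <= total_error (det_oracle z) S)%E.
Proof.
move=> STheta eqtr; rewrite /total_error.
have sup_ge : (outcome_prob (det_oracle z) (ising Theta) false <=
    ereal_sup [set outcome_prob (det_oracle z) (ising Theta) false
              | Theta in S])%E.
  by apply: ereal_sup_ubound; exists Theta.
have o0 b P : (0 <= outcome_prob (det_oracle z) P b)%E by exact: measure_ge0.
have o1 b P : alg_psi (transcript (z P)) = b ->
    outcome_prob (det_oracle z) P b = 1%E.
  move=> zb; rewrite /outcome_prob (_ : @outcome _ _ _ _ _ _ = setT).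
    exact: probability_setT.
  by apply/seteqP; split.
case E : (alg_psi (transcript (z (ising 0)))).
  by rewrite o1// leeDl// (le_trans _ sup_ge).
rewrite (le_trans _ (leeDr _ (o0 _ _)))// (le_trans _ sup_ge)// o1//.
by rewrite -eqtr.
Qed.

Lemma capacity_ge0 (cap : set (query R d) -> R) Q : is_capacity cap ->
  Q `<=` @Qstar R d -> Q !=set0 -> 0 <= cap Q.
Proof.
move=> capP QQ Q0; have [capf capi] := capP Q QQ Q0.
have [Qf|Qi] := pselect (finite_set Q); last by rewrite ltW// capi.
rewrite capf// ln_ge0// ler1n finmap.cardfs_gt0.
apply/negP => /eqP /(fset_set_set0 Qf) E.
by have [q] := Q0; rewrite E.
Qed.

(** The null transcript is fixed before the alternative is chosen, so adaptive queries reduce to a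
    list of at most [T]. *)
Lemma oracle_risk_ge1 (cap : set (query R d) -> R) (n T : nat)
    (S : set 'M[R]_d) : is_capacity cap ->
    (forall q : 'I_T -> query R d, exists2 Theta, S Theta & forall k,
      (`|mean (ising 0) (q k) - mean (ising Theta) (q k)|%:E
         <= psi1 (ising Theta) (q k) * (Num.sqrt (1 / n%:R))%:E)%E) ->
  (1 <= oracle_risk cap n T S)%E.
Proof.
move=> capP fool; apply: le_ereal_inf_tmp => _ [A AT ->].
set z := @null_answer n (cap (alg_Q A)) (alg_Q A).
apply: (@le_trans _ _ (total_error (det_oracle z) S)); last first.
  apply: ereal_sup_ubound; exists (det_oracle z); split=> //.
  exact: null_oracle_valid.
have cap0 : 0 <= cap (alg_Q A).
  apply: capacity_ge0 => //; first exact: alg_Qstar.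
  by exists (\val (alg_init A)); exact: set_valP.
(* If the run stops before [T] rounds, the list is completed by the initial query. *)
pose asked (i : nat) :=
  nth (alg_init A) (unzip1 (transcript (z (ising 0)))) i.
have [M SM acc] := fool (fun k => \val (asked k)).
apply: total_error_ge1 SM _; apply: eq_transcript => i iT q.
have iT' : (i < T)%N.
  by apply: leq_trans AT; exact: leq_trans iT (size_transcript _).
rewrite /z null_answer0 /null_answer; case: asboolP => // nacc; exfalso.
apply: nacc; apply: le_trans (acc (Ordinal iT')) _.
by apply: lee_wpmul2l; [exact: psi1_ge0|exact: tau_half_ge].
Qed.

Definition zero_queries : set (query R d) := [set fun=> 0].

Lemma zero_queries_Qstar : zero_queries `<=` @Qstar R d.
Proof.
move=> _ -> P; apply: (@le_lt_trans _ _ 0%E); last by rewrite ltry.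
apply: ge_ereal_sup => _ [p /= p1 <-].
have p0 : p != 0 by rewrite gt_eqF// (lt_le_trans ltr01).
rewrite lee_fin /mean big1 ?powR0 ?mulr0// ?invr_eq0// => x _.
by rewrite normr0 powR0// mulr0.
Qed.

(** Achieved by always rejecting without asking; the query space still needs an element for
    [alg_init]. *)
Lemma oracle_risk_le1 (cap : set (query R d) -> R) (n T : nat)
  (S : set 'M[R]_d) : (oracle_risk cap n T S <= 1)%E.
Proof.
have mem0 : (fun=> 0) \in zero_queries by apply: mem_set.
pose A := Algorithm zero_queries_Qstar 0 (SigSub mem0 : zero_queries)
  (fun=> None) (fun=> true).
apply: (@le_trans _ _ (worst_error cap n A S)).
  by apply: ereal_inf_lbound; exists A.
apply: ge_ereal_sup => _ [r [_ mr ->]].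
rewrite /total_error -[leRHS]adde0; apply: leeD.
  exact: probability_le1.
apply: ge_ereal_sup => _ [M _ <-].
rewrite /outcome_prob (_ : @outcome _ _ _ _ _ _ = set0) ?measure0//.
by apply/seteqP; split.
Qed.

End Oracles.

(** * Arithmetic of the parameter regime *)

Section Regime.
Variables (R : realType) (p eta : R) (K d s T : nat).

(** Since [s ^ 2 * d ^ eta <= d], the ratio [m / s] is at least [d ^ eta / 2], and its power [K + 1]
    brings [d ^ (p + 3)]: [d ^ p] pays for [T], [d ^ 2] for [s ^ 4], and the last [d] for the
    constants [2 ^ (K + 4)]. *)
Lemma query_budget : 0 < eta -> p + 3 <= eta * K.+1%:R ->
    (2 ^ (K + 4) <= d)%N -> (0 < s)%N ->
    T%:R <= d%:R `^ p -> s%:R <= d%:R `^ ((1 - eta) / 2) ->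
  (s <= d %/ s)%N /\
  2 * T%:R * expR 1 * s%:R ^+ K.+1 * s%:R ^+ 4
    <= (d %/ s)%:R ^+ K.+1 :> R.
Proof.
move=> eta0 pK dK s0 Td sd; set m := (d %/ s)%N.
have d1 : (0 < d)%N by apply: leq_trans dK; rewrite expn_gt0.
have dR : 1 <= d%:R :> R by rewrite ler1n.
have dR0 : 0 <= d%:R :> R by exact: ler0n.
have dn0 : d%:R != 0 :> R by rewrite pnatr_eq0 -lt0n.
have sR : 0 < s%:R :> R by rewrite ltr0n.
set x := d%:R `^ eta : R.
have x1 : 1 <= x.
  have := @ler_powR R d%:R dR _ _ (ltW eta0).
  by rewrite powRr0.
have s2x : s%:R ^+ 2 * x <= d%:R.
  have s2 : s%:R ^+ 2 <= d%:R `^ (1 - eta).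
    rewrite (_ : 1 - eta = (1 - eta) / 2 * 2%:R); last by rewrite divfK.
    rewrite powRrM powR_mulrn ?powR_ge0//.
    by rewrite ler_sqr ?nnegrE ?powR_ge0// ltW.
  apply: le_trans (ler_wpM2r (le_trans ler01 x1) s2) _.
  by rewrite -powRD ?subrK ?powRr1// dn0 implybT.
have s2d : s%:R ^+ 2 <= d%:R :> R.
  by apply: le_trans s2x; rewrite ler_peMr// sqr_ge0.
have s_le_m : (s <= m)%N.
  by rewrite leq_divRL// -(ler_nat R) natrM -expr2.
split => //.
(* Rounding [d / s] down costs at most a factor 2, as [m >= 1]. *)
have dms : d%:R <= 2 * s%:R * m%:R :> R.
  have h : (d < m.+1 * s)%N by exact: ltn_ceil.
  have m0 : (0 < m)%N by exact: leq_trans s_le_m.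
  have : (d <= 2 * s * m)%N.
    apply: leq_trans (ltnW h) _; rewrite mulnAC leq_mul2r.
    by rewrite -addn1 mul2n -addnn leq_add2l m0 orbT.
  by rewrite -(ler_nat R) !natrM.
have xK : T%:R * d%:R ^+ 3 <= x ^+ K.+1.
  rewrite -powR_mulrn ?powR_ge0// -powRrM.
  apply: le_trans (ler_powR dR pK).
  rewrite powRD ?dn0 ?implybT// ler_pM ?exprn_ge0//.
  by rewrite powR_mulrn.
have s4 : s%:R ^+ 4 <= d%:R ^+ 2 :> R.
  by rewrite (exprM _ 2 2) lerXn2r ?nnegrE ?sqr_ge0.
have main : 2 ^+ (K + 4) * T%:R * s%:R ^+ 4 * (s%:R ^+ 2) ^+ K.+1
    <= d%:R ^+ K.+1 :> R.
  have dK' : 2 ^+ (K + 4) <= d%:R :> R by rewrite -natrX ler_nat.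
  apply: le_trans (lerXn2r K.+1 _ _ s2x); rewrite ?nnegrE ?mulr_ge0 ?sqr_ge0//;
    last exact: le_trans x1.
  rewrite [leRHS]exprMn [leRHS]mulrC ler_wpM2r ?exprn_ge0 ?sqr_ge0//.
  apply: le_trans xK; rewrite [2 ^+ _ * _]mulrC -mulrA ler_wpM2l//.
  by rewrite exprS ler_pM// exprn_ge0.
have s2K : 0 < (2 * s%:R) ^+ K.+1 :> R by rewrite exprn_gt0// mulr_gt0.
rewrite -(ler_pM2l s2K) -exprMn.
apply: (@le_trans _ _ (d%:R ^+ K.+1)); last first.
  by rewrite lerXn2r ?nnegrE ?mulr_ge0.
apply: le_trans main.
have e4 := expR1_le4 R.
rewrite exprMn -exprM mul2n -addnn exprD exprD.
have -> : 2 ^+ K.+1 = 2 * 2 ^+ K :> R by rewrite exprS.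
have -> : 2 ^+ 4 = 16 :> R by rewrite -natrX.
have k0 : 0 <= 2 ^+ K * (s%:R ^+ K.+1 * s%:R ^+ K.+1) * T%:R * s%:R ^+ 4 :> R.
  by rewrite !mulr_ge0// exprn_ge0// ltW.
have := ler_wpM2l k0 e4.
move: (2 ^+ K) (s%:R ^+ K.+1) (s%:R ^+ 4) (T%:R) (expR 1) => a b c t e.
lra.
Qed.

End Regime.

(** * From indistinguishable cliques to the limit of the risk *)

Lemma signals_fool (R : realType) (d s m n T K : nat) (theta : R)
    (Gstar : rel 'I_d) (q : 'I_T -> query R d) :
    simple_graph Gstar -> #|nonisolated Gstar| = s -> 0 < theta ->
    ((0 < s)%N -> [/\ (s * m <= d)%N, (s <= m)%N, 16 * theta * s%:R <= 1,
      2 * T%:R * expR 1 * s%:R ^+ K.+1 * s%:R ^+ 4 <= m%:R ^+ K.+1 :> R &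
      8 * theta * distinguish_const R K <= Num.sqrt (1 / n%:R)]) ->
  exists2 Theta, signals (G1 Gstar) theta Theta & forall k,
    (`|mean (ising 0) (q k) - mean (ising Theta) (q k)|%:E
       <= psi1 (ising Theta) (q k) * (Num.sqrt (1 / n%:R))%:E)%E.
Proof.
move=> Gsimple Gs t0; have [s0 _|s0 /(_ isT)[smd sm ts Km kappa]] := posnP s.
  (* Without non-isolated vertices the empty clique is admissible, and its law is the null law. *)
  exists (clique theta finset.set0).
    by apply: clique_signals; rewrite ?cards0 ?Gs ?s0 ?mulr0.
  move=> k; have -> : clique theta finset.set0 = 0 :> 'M[R]_d.
    by apply/matrixP => i j; rewrite !mxE finset.in_set0 andbF.
  by rewrite subrr normr0 mule_ge0 ?psi1_ge0// lee_fin sqrtr_ge0.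
have [phi phi_inj] := exists_injection smd.
have [f ff] := exists_indistinguishable q phi_inj (ltW t0) s0 sm ts Km.
have cA := card_transversal_set phi_inj f.
exists (clique theta (transversal_set phi f)).
  by apply: clique_signals; rewrite ?cA.
move=> k; have psi_ge := psi1_clique_ge (q k) (ltW t0) s0 ts (eq_leq cA).
apply: le_trans (lee_wpmul2r _ psi_ge); last by rewrite lee_fin sqrtr_ge0.
rewrite lee_fin distrC; apply: le_trans (ff k) _.
(* The 8 in [kappa] compensates the one lost in [psi1_clique_ge]. *)
have := ler_wpM2l (sqrtr_ge0 (avg (fun x => q k x ^+ 2))) kappa; lra.
Qed.

Theorem theoremB3 (R : realType) (p eta : R) (hp : 0 < p) (heta : 0 < eta) :
  exists2 kappa : R, 0 < kappa &
    forall (cap : forall d : nat, set (query R d) -> R)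
      (d s T : nat -> nat) (theta : nat -> R)
      (Gstar : forall n : nat, rel 'I_(d n)),
      (forall k, is_capacity (cap k)) ->
      d n @[n --> \oo] --> \oo ->
      (forall n, 0 < theta n) ->
      (forall n, simple_graph (Gstar n)) ->
      (forall n, s n = #|nonisolated (Gstar n)|) ->
      (forall n, (T n)%:R <= (d n)%:R `^ p) ->
      (forall n, (s n)%:R <= (d n)%:R `^ ((1 - eta) / 2)) ->
      (forall n, (0 < n)%N -> theta n <= kappa * Num.sqrt (1 / n%:R)) ->
      (forall n, (0 < s n)%N -> theta n <= 1 / (16 * (s n)%:R)) ->
      limn_einf (fun n => oracle_risk (cap (d n)) n (T n)
                            (signals (G1 (Gstar n)) (theta n))) = 1%:E.
Proof.
(* [K] depends on [p] and [eta] only, hence so does the constant [(8 * D)^-1] chosen for [kappa]. *)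
pose K := Num.bound ((p + 3) / eta).
have pK : p + 3 <= eta * K.+1%:R.
  have pe : 0 <= (p + 3) / eta by rewrite divr_ge0// ?ltW// addr_gt0.
  have := archi_boundP pe; rewrite -/K ltr_pdivrMr// mulrC => /ltW/le_trans.
  by apply; rewrite ler_pM2l// ler_nat.
pose D := distinguish_const R K.
have D0 : 0 < 8 * D by apply: mulr_gt0 => //; exact: distinguish_const_gt0.
exists (8 * D)^-1; first by rewrite invr_gt0.
move=> cap d s T theta Gstar capP d_oo t0 Gsimple sE Td sd tn ts.
suff cvg1 : oracle_risk (cap (d n)) n (T n)
    (signals (G1 (Gstar n)) (theta n)) @[n --> \oo] --> 1%E.
  by have [-> _] := cvg_limn_einf_sup cvg1.
(* The risk is exactly 1 once [n > 0] and [d n >= 2 ^ (K + 4)]. *)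
apply: cvg_near_cst; near=> n.
apply/eqP; rewrite eq_le oracle_risk_le1 oracle_risk_ge1// => q.
apply: (@signals_fool _ _ (s n) (d n %/ s n) n (T n) K) => // s0.
have dn : (2 ^ (K + 4) <= d n)%N by near: n; exact: (d_oo _ (nbhs_infty_ge _)).
have [sm Km] := query_budget heta pK dn s0 (Td n) (sd n).
have sR : 0 < (s n)%:R :> R by rewrite ltr0n.
split=> //.
- by rewrite mulnC leq_trunc_div.
- have := ts n s0; rewrite ler_pdivlMr ?mulr_gt0//; lra.
- have n0 : (0 < n)%N by near: n; exact: nbhs_infty_gt.
  have := tn n n0; rewrite ler_pdivlMl// mulrAC.
Unshelve. all: by end_near. Qed.
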